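(* Let $K\subset L^2_0(\mu)$ be a closed subspace with $P_t(K)\subset K$ for all $t\ge0$, let $L_K$ be the generator of the restricted semigroup $(P_t|_K)_{t\ge0}$, and assume $$\gamma_K:=\inf_{f\in\operatorname{Dom}(L_K)\setminus\{0\}}\frac{\|L_Kf\|}{\|f\|}>0.$$ Then for every $t>0$ and every $g\in K$, $$\left|\operatorname{Var}_\mu(\mu_tg)-\frac{\sigma_g^2}{t}\right|\le\frac{4}{\gamma_K^2t^2}\|g\|^2 .$$ Consequently, for every $t>0$, $$\frac{\sigma_K^2}{t}-\frac{4}{\gamma_K^2t^2}\le\bigl(\Delta_t^K\bigr)^2\le\frac{\sigma_K^2}{t}+\frac{4}{\gamma_K^2t^2}.$$
   Context: Let $(X_t)_{t\ge0}$ be a time-homogeneous Markov process on a measurable space $S$, with jointly measurable sample paths and an invariant probability measure $\mu$. $L^2(\mu)$ is the space of complex-valued square-integrable functions with $\langle f,g\rangle=\int \bar f g\,d\mu$ and norm $\|\cdot\|$; $L^2_0(\mu)=\{g\in L^2(\mu):\int g\,d\mu=0\}$. The semigroup $P_tg(x)=\mathbb E_x[g(X_t)]$ is assumed strongly continuous on $L^2(\mu)$; its generator is $Lg=\lim_{t\downarrow0}(P_tg-g)/t$ with $\operatorname{Dom}(L)$ the set of $g$ for which the limit exists in $L^2(\mu)$; $L_K$ is $L$ restricted to $\operatorname{Dom}(L_K)=\operatorname{Dom}(L)\cap K$. $\mathbb E_\mu$ denotes expectation for the process started from $X_0\sim\mu$. Write $\mu g=\int g\,d\mu$, $\mu_tg=\frac1t\int_0^tg(X_s)\,ds$,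 $\operatorname{Var}_\mu(\mu_tg)=\mathbb E_\mu|\mu_tg-\mu g|^2$, and $\Delta_t^K:=\sup_{g\in K,\ \|g\|=1}\sqrt{\operatorname{Var}_\mu(\mu_tg)}$. The asymptotic variance of $g$ is $\sigma_g^2:=\lim_{t\to\infty}t\operatorname{Var}_\mu(\mu_tg)$; under the hypotheses $L_K$ has a bounded inverse on $K$ with $\|L_K^{-1}\|\le\gamma_K^{-1}$, the limit exists for every $g\in K$, and $\sigma_g^2=2\operatorname{Re}\langle g,-L_K^{-1}g\rangle$. The worst-case asymptotic variance on $K$ is $\sigma_K^2:=\sup_{g\in K,\ \|g\|=1}\sigma_g^2$. Conventions: $\inf\emptyset=+\infty$, $\sup\emptyset=0$, $1/\infty=0$. *)

(* Defs.v *)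
From HB Require Import structures.
From mathcomp Require Import all_boot all_order all_algebra.
From mathcomp Require Import complex.
From mathcomp Require Import all_classical all_reals all_analysis.

Set Implicit Arguments.
Unset Strict Implicit.
Unset Printing Implicit Defensive.

Import Order.TTheory GRing.Theory Num.Theory.
Import numFieldNormedType.Exports.

Local Open Scope classical_set_scope.
Local Open Scope ring_scope.

Section ComplexL2.
Context d (T : measurableType d) (R : realType).
Implicit Types (m : {measure set T -> \bar R}) (f g : T -> R[i]).
Implicit Types K : set (T -> R[i]).

Definition cmeasurable f : Prop :=
  measurable_fun setT (fun x => complex.Re (f x)) /\
  measurable_fun setT (fun x => complex.Im (f x)).

Definition cintegral m (D : set T) f : R[i] :=
  Complex (\int[m]_(x in D) complex.Re (f x)) (\int[m]_(x in D) complex.Im (f x)).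

Definition normL2 m f : \bar R :=
  'N[m]_2%:E[(fun x => (ComplexField.Normc.normc (f x))%:E)]%E.

(* L2 functions are not quotiented by a.e. equality: a subset of L^2(m) is
   given by the set of all representatives of its elements. *)
Definition L2 m : set (T -> R[i]) :=
  [set f | cmeasurable f /\ (normL2 m f < +oo)%E].

Definition L20 m : set (T -> R[i]) :=
  [set f | L2 m f /\ cintegral m setT f = 0].

(* [csub_closed] includes stability under a.e. equality, since it applies to
   any [f] at distance 0 from an element of [K]. *)
Record closed_subspace m K : Prop := ClosedSubspace {
  csub_L2 : K `<=` L2 m ;
  csub_0 : K (fun=> 0) ;
  csub_add : forall f g, K f -> K g -> K (fun x => f x + g x) ;
  csub_scale : forall (a : R[i]) f, K f -> K (fun x => a * f x) ;
  csub_closed : forall f, L2 m f ->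
    (forall e : R, 0 < e ->
       exists2 g, K g & (normL2 m (fun x => g x - f x)%R < e%:E)%E) ->
    K f
}.

End ComplexL2.

Section StartedFrom.
Context dS (S : measurableType dS) dO (Omega : measurableType dO) (R : realType).
Variables (mu : probability S R) (P : R.-pker S ~> Omega).
Local Open Scope ereal_scope.

(* The law of the process started from the initial distribution [mu]. *)
Definition started_from (A : set Omega) : \bar R := \int[mu]_x P x A.

Let started_from0 : started_from set0 = 0.
Proof. by apply: integral0_eq => x _; rewrite measure0. Qed.

Let started_from_ge0 A : 0 <= started_from A.
Proof. by apply: integral_ge0 => x _; exact: measure_ge0. Qed.

Let started_from_sigma_additive : semi_sigma_additive started_from.
Proof.
move=> F mF tF mUF.
have -> : started_from (\bigcup_n F n) = \sum_(n <oo) started_from (F n).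
  rewrite -integral_nneseries//; last by move=> n; exact: measurable_kernel.
  apply: eq_integral => x _.
  exact: measure_semi_bigcup.
exact: is_cvg_ereal_nneg_natsum.
Qed.

HB.instance Definition _ := isMeasure.Build dO Omega R started_from
  started_from0 started_from_ge0 started_from_sigma_additive.

Let started_from_setT : started_from setT = 1.
Proof.
rewrite /started_from (eq_integral (cst 1)); last first.
  by move=> x _; exact: prob_kernel.
by rewrite integral_cst// mul1e; exact: probability_setT.
Qed.

HB.instance Definition _ :=
  Measure_isProbability.Build dO Omega R started_from started_from_setT.

End StartedFrom.

Section Markov.
Context dS (S : measurableType dS) dO (Omega : measurableType dO) (R : realType).
Variables (X : R -> Omega -> S) (P : R.-pker S ~> Omega).
Implicit Types (g h : S -> R[i]) (K : set (S -> R[i])).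

Definition past (s : R) : set (set Omega) :=
  <<s \bigcup_(u in `[0, s]) preimage_set_system setT (X u) measurable >>.

(* [P x] is the law of the process started at [x]; only the values of [X] at
   nonnegative times matter. *)
Record markov_process : Prop := MarkovProcess {
  markov_measurable :
    measurable_fun ([set t : R | 0 <= t] `*` [set: Omega])
      (fun tw : R * Omega => X tw.1 tw.2) ;
  markov_initial : forall x A, measurable A ->
    P x (X 0 @^-1` A) = (\d_x A)%E ;
  markov_property : forall x s t A B, 0 <= s -> 0 <= t -> measurable A ->
    past s B ->
    (P x (B `&` X (s + t) @^-1` A) = \int[P x]_(w in B) P (X s w) (X t @^-1` A))%E
}.

Definition invariant_law (mu : probability S R) : Prop :=
  forall t A, 0 <= t -> measurable A -> started_from mu P (X t @^-1` A) = mu A.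

(* For [g] in L2 of an invariant law, [g (X t w)] is [P x]-integrable for almost
   every [x] only; elsewhere the value of the integral is irrelevant. The same
   remark applies to [time_average] below, for almost every [w]. *)
Definition semigroup (t : R) g : S -> R[i] :=
  fun x => cintegral (P x) setT (fun w => g (X t w)).

Variable mu : probability S R.

Definition strongly_continuous : Prop :=
  forall g, L2 mu g ->
    normL2 mu (fun x => semigroup t g x - g x)%R @[t --> 0^'+] --> 0%E.

(* The graph of the generator: [g] is in the domain and [L g = h]. *)
Definition generator g h : Prop :=
  [/\ L2 mu g, L2 mu h &
    normL2 mu (fun x => (t^-1)%:C%C * (semigroup t g x - g x) - h x)%R
      @[t --> 0^'+] --> 0%E].

Definition generator_on K g h : Prop := K g /\ generator g h.

(* [inf |L_K g| / |g|] over nonzero [g] in the domain; it is [+oo], with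
   inverse 0, when there is no such [g]. *)
Definition gap K : \bar R :=
  ereal_inf [set r | exists g h, [/\ generator_on K g h, normL2 mu g != 0%E &
                                     r = (normL2 mu h / normL2 mu g)%E]].

Definition time_average (t : R) g (w : Omega) : R[i] :=
  (t^-1)%:C%C * cintegral lebesgue_measure `[0, t] (fun s => g (X s w)).

Definition var_average (t : R) g : \bar R :=
  'E_(started_from mu P)[(fun w =>
     ComplexField.Normc.normc (time_average t g w - cintegral mu setT g)%R ^+ 2)%R]%E.

Definition asymptotic_var g : \bar R :=
  lim ((t%:E * var_average t g)%E @[t --> +oo]).

(* Supremum of a set of nonnegative numbers, with value 0 on the empty set. *)
Definition nnsup (A : set (\bar R)) : \bar R :=
  if A == set0 then 0%E else ereal_sup A.

Definition worst_asymptotic_var K : \bar R :=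
  nnsup [set asymptotic_var g | g in K `&` [set g | normL2 mu g = 1%E]].

Definition worst_deviation (t : R) K : \bar R :=
  nnsup [set sqrte (var_average t g) | g in K `&` [set g | normL2 mu g = 1%E]].

End Markov.

(* Main.v *)
Require Import Defs.
From HB Require Import structures.
From mathcomp Require Import all_boot all_order all_algebra.
From mathcomp Require Import complex.
From mathcomp Require Import all_classical all_reals all_analysis.
From mathcomp Require Import measurable_realfun lebesgue_measure.
From mathcomp Require Import ring lra.

Set Implicit Arguments.
Unset Strict Implicit.
Unset Printing Implicit Defensive.

Import Order.TTheory GRing.Theory Num.Theory.
Import numFieldNormedType.Exports.

Local Open Scope classical_set_scope.
Local Open Scope ring_scope.
Local Open Scope ereal_scope.


(** The squared deviation of a time average is a quadratic form in the semigroup: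
    if [Z_t = \int_0^t g(X_s) ds], then stationarity gives
    [E |Z_t|^2 = 2 Re \int_0^t (t - s) <g, P_s g> ds = 2 t Re <g, A_t g>], where
    [A_t g = t^-1 \int_0^t S_u g du] is the Cesaro mean of [S_u g = \int_0^u P_s g ds].
    The proof never inverts the generator [L]; it only uses that these integrals
    lie in its domain. Indeed [L (S_u g) = P_u g - g], so the spectral gap gives
    [|S_u g| <= 2 |g| / gamma] for all [u]. Averaging,
    [L (A_t g) = S_t g / t - g], hence [L (A_t g - A_s g) = S_t g / t - S_s g / s]:
    the term [g] cancels, and a second use of the gap yields
    [|A_t g - A_s g| <= 2 |g| / gamma^2 * (1/t + 1/s)]. Therefore
    [t Var(mu_t g)] is a Cauchy function of [t], with
    [|t Var(mu_t g) - s Var(mu_s g)| <= 4 |g|^2 / gamma^2 * (1/t + 1/s)].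
    Its limit is the asymptotic variance, and letting [s] go to infinity is
    the announced bound, with its constant 4. Only real parts of scalar products
    occur, so everything takes place in real vector spaces.

    This argument is [second_moment_cauchy], stated for two abstract real vector
    spaces with semi-inner products, which stand for [L^2(mu)] and for [L^2] of the
    law of the stationary process, and three kinds of maps between them:
    evaluation [I s] at time [s], conditioning [U] on the initial state, and
    integration [Z a b] along the path. All Hilbert space valued integrals in it
    are replaced by Riemann sums: they converge uniformly because the stationary
    process is mean-square continuous as soon as the semigroup is strongly
    continuous.

    The measure theory then checks the hypotheses. [Rintegral_mixture]
    integrates against a mixture of measures; it gives both the disintegration of
    the stationary law along the initial state and the Chapman-Kolmogorov relation
    ([chapman_kolmogorov]). [dot_cond_exp] says that conditioning is the adjoint of
    evaluation at time 0, [dot_stationary] that pairs of times have shift-invariant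
    laws, and [path_integral_loc] that path integrals over short intervals are close
    to rectangles. An infinite gap is treated as the limit of finite ones: the bound
    then holds with every [gamma], hence with the constant 0. *)

(** * Second moments of path integrals in semi-inner product spaces *)

(** Definiteness is left out because functions are not identified when they are
    equal almost everywhere. *)
Record semi_inner (R : realType) (V : lmodType R) (d : V -> V -> R) : Prop :=
  SemiInner {
  siC : forall x y, d x y = d y x ;
  siD : forall x y z, d x (y + z)%R = (d x y + d x z)%R ;
  siZ : forall x a y, d x (a *: y)%R = (a * d x y)%R ;
  si_ge0 : forall x, (0 <= d x x)%R }.

Section SemiInnerTheory.
Context (R : realType) (V : lmodType R) (d : V -> V -> R).
Hypothesis hd : semi_inner d.
Local Open Scope ring_scope.

Definition snorm x := Num.sqrt (d x x).

Lemma siN x y : d x (- y) = - d x y.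
Proof. by rewrite -scaleN1r (siZ hd) mulN1r. Qed.

Lemma siB x y z : d x (y - z) = d x y - d x z.
Proof. by rewrite (siD hd) siN. Qed.

Lemma si0 x : d x 0 = 0.
Proof. by rewrite -(scale0r 0) (siZ hd) mul0r. Qed.

Lemma si_sum x n (F : 'I_n -> V) : d x (\sum_(k < n) F k) = \sum_(k < n) d x (F k).
Proof. by elim/big_rec2: _ => [|i y1 y2 _ <-]; rewrite ?si0 ?(siD hd). Qed.

Lemma siDl x y z : d (y + z) x = d y x + d z x.
Proof. by rewrite (siC hd) (siD hd) !(siC hd x). Qed.

Lemma siZl x a y : d (a *: y) x = a * d y x.
Proof. by rewrite (siC hd) (siZ hd) (siC hd x). Qed.

Lemma siNl x y : d (- y) x = - d y x.
Proof. by rewrite (siC hd) siN (siC hd x). Qed.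

Lemma siBl x y z : d (y - z) x = d y x - d z x.
Proof. by rewrite siDl siNl. Qed.

Lemma snorm_ge0 x : 0 <= snorm x.
Proof. exact: sqrtr_ge0. Qed.

Lemma sqr_snorm x : snorm x ^+ 2 = d x x.
Proof. by rewrite sqr_sqrtr// (si_ge0 hd). Qed.

Lemma snormZ a x : snorm (a *: x) = `|a| * snorm x.
Proof.
rewrite /snorm siZl (siZ hd) mulrA -expr2 sqrtrM ?sqr_ge0//.
by rewrite sqrtr_sqr.
Qed.

Lemma sqr_snormD x a y :
  snorm (x + a *: y) ^+ 2 = snorm x ^+ 2 + 2 * a * d x y + a ^+ 2 * snorm y ^+ 2.
Proof.
by rewrite !sqr_snorm siDl !(siD hd) !siZl !(siZ hd) (siC hd y x); ring.
Qed.

Lemma snormN x : snorm (- x) = snorm x.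
Proof. by rewrite -scaleN1r snormZ normrN1 mul1r. Qed.

Lemma snorm0 : snorm 0 = 0.
Proof. by rewrite /snorm si0 sqrtr0. Qed.

Lemma cauchy_schwarz x y : `|d x y| <= snorm x * snorm y.
Proof.
rewrite -ler_sqr ?nnegrE ?mulr_ge0 ?snorm_ge0// exprMn !sqr_snorm real_normK ?num_real//.
have q (s : R) : 0 <= d x x - 2 * s * d x y + s ^+ 2 * d y y.
  have := si_ge0 hd (x - s *: y).
  rewrite siBl !siB !(siZ hd) !siZl (siC hd y x).
  by move/le_trans; apply; rewrite le_eqVlt; apply/orP; left; apply/eqP; ring.
(* For [d y y = 0] the lower bound in [q] is affine in [s], so [d x y = 0]. *)
have [c0|c0] := eqVneq (d y y) 0.
  have [->|b0] := eqVneq (d x y) 0; first by rewrite c0 mulr0 expr0n.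
  have := q ((d x x + 1) / (2 * d x y)); rewrite c0 mulr0 addr0.
  have -> : 2 * ((d x x + 1) / (2 * d x y)) * d x y = d x x + 1 by field.
  by lra.
have cp : 0 < d y y by rewrite lt_def c0 (si_ge0 hd).
have := q (d x y / d y y).
have -> : d x x - 2 * (d x y / d y y) * d x y + (d x y / d y y) ^+ 2 * d y y
  = d x x - d x y ^+ 2 / d y y by field.
by rewrite subr_ge0 ler_pdivrMr.
Qed.

Lemma snormD x y : snorm (x + y) <= snorm x + snorm y.
Proof.
rewrite -ler_sqr ?nnegrE ?addr_ge0 ?snorm_ge0// sqrrD !sqr_snorm.
rewrite siDl !(siD hd) (siC hd y x).
have := le_trans (ler_norm _) (cauchy_schwarz x y); lra.
Qed.

Lemma snormB x y : snorm (x - y) <= snorm x + snorm y.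
Proof. by rewrite -(snormN y) snormD. Qed.

Lemma snorm_distC x y : snorm (x - y) = snorm (y - x).
Proof. by rewrite -snormN opprB. Qed.

Lemma snorm_trans z x y : snorm (x - y) <= snorm (x - z) + snorm (z - y).
Proof. by rewrite -[x in leLHS](subrK z) -addrA snormD. Qed.

(** Equivalent to being at distance 0; equality of functionals can be used by
    rewriting. *)
Definition weq x y := forall h, d h x = d h y.

Lemma weq_snorm x y : weq x y -> snorm x = snorm y.
Proof. by move=> xy; rewrite /snorm xy (siC hd) xy. Qed.

Lemma snorm0_weq x y : snorm (x - y) = 0 -> weq x y.
Proof.
move=> xy h; apply/eqP; rewrite -subr_eq0 -siB -normr_le0.
by rewrite (le_trans (cauchy_schwarz _ _))// xy mulr0.
Qed.

Lemma weqB x y z : weq x y -> weq (x - z) (y - z).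
Proof. by move=> xy h; rewrite !siB xy. Qed.

Lemma snorm_lim0 x y (c : R) : (forall e, 0 < e -> snorm (x - y) <= c * e) -> weq x y.
Proof.
move=> H; apply: snorm0_weq; apply/eqP; rewrite eq_le snorm_ge0 andbT.
have c0 : 0 <= c by have := le_trans (snorm_ge0 _) (H 1 ltr01); rewrite mulr1.
apply/ler_addgt0Pr => e e0; rewrite add0r.
have c1 : 0 < c + 1 by lra.
apply: (le_trans (H (e / (c + 1)) _)); first by rewrite divr_gt0.
by rewrite mulrCA ger_pMr// ler_pdivrMr// mul1r; lra.
Qed.

End SemiInnerTheory.

Section AbstractProcess.
Context (R : realType) (V W : lmodType R) (dV : V -> V -> R) (dW : W -> W -> R).
Hypotheses (hV : semi_inner dV) (hW : semi_inner dW).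
Local Open Scope ring_scope.

(* [I s x] is [x] evaluated along the process at time [s], [U] the conditional
   expectation given the initial state, [Z a b x] the integral of [I s x] over
   [s] between [a] and [b]. *)
Context (I : R -> V -> W) (U : W -> V) (Z : R -> R -> V -> W).
Hypothesis I_D : forall (s : R) x y, I s (x + y) = I s x + I s y.
Hypothesis I_Z : forall (s a : R) x, I s (a *: x) = a *: I s x.
Hypothesis I_iso : forall (s : R) x y, 0 <= s -> dW (I s x) (I s y) = dV x y.
Hypothesis U_adj : forall h z, dV h (U z) = dW (I 0 h) z.

Local Notation nV := (snorm dV).
Local Notation nW := (snorm dW).
Let P t x := U (I t x).

Hypothesis semigroupP : forall (r s : R) x, 0 <= r -> 0 <= s ->
  weq dV (P r (P s x)) (P (r + s) x).
Hypothesis stationary : forall (s t : R) x y, 0 <= s -> 0 <= t ->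
  dW (I s x) (I (s + t) y) = dW (I 0 x) (I t y).
Hypothesis Z_add : forall (a b c : R) x, 0 <= a -> a <= b -> b <= c ->
  weq dW (Z a b x + Z b c x) (Z a c x).
Hypothesis Z_loc : forall (a b : R) x (M : R), 0 <= a -> a <= b -> 0 <= M ->
  (forall s, a <= s <= b -> nW (I s x - I a x) <= M) ->
  nW (Z a b x - (b - a) *: I a x) <= (b - a) * M.
Hypothesis P_cont : forall x (e : R), 0 < e ->
  exists2 r0 : R, 0 < r0 & forall r, 0 < r < r0 -> nV (P r x - x) <= e.

(** [U y] up to a null vector. Besides [U y] itself this covers the Riemann sums in
   [V], whose counterparts in [W] are Riemann sums of the path; so every estimate
   made in [W] passes to [V] by [adj_le]. *)
Let adj x y := forall h, dV h x = dW (I 0 h) y.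

Let adj_le x y : adj x y -> nV x <= nW y.
Proof.
move=> xy; have [->|x0] := eqVneq (nV x) 0; first exact: snorm_ge0.
have xp : 0 < nV x by rewrite lt_def x0 snorm_ge0.
rewrite -(ler_pM2l xp) -expr2 (sqr_snorm hV) xy.
apply: (le_trans (ler_norm _)); apply: (le_trans (cauchy_schwarz hW _ _)).
by rewrite ler_wpM2r ?snorm_ge0// /snorm I_iso.
Qed.

Let nI s x : 0 <= s -> nW (I s x) = nV x.
Proof. by move=> s0; rewrite /snorm I_iso. Qed.

Let I_B s x y : I s (x - y) = I s x - I s y.
Proof. by rewrite I_D -scaleN1r I_Z scaleN1r. Qed.

Let P_B r x y : weq dV (P r (x - y)) (P r x - P r y).
Proof. by move=> h; rewrite (siB hV) !U_adj I_B (siB hW). Qed.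

Let P_D r x y : weq dV (P r (x + y)) (P r x + P r y).
Proof. by move=> h; rewrite (siD hV) !U_adj I_D (siD hW). Qed.

Let P_Z r a x : weq dV (P r (a *: x)) (a *: P r x).
Proof. by move=> h; rewrite (siZ hV) !U_adj I_Z (siZ hW). Qed.

Let P_le r x : 0 <= r -> nV (P r x) <= nV x.
Proof. by move=> r0; rewrite -(nI x r0); apply: adj_le => h; exact: U_adj. Qed.

Let P_lip r x y : 0 <= r -> nV (P r x - P r y) <= nV (x - y).
Proof. by move=> r0; rewrite -(weq_snorm hV (P_B r x y)) P_le. Qed.

Let osc x u M := forall a s, 0 <= a -> a <= s <= a + u -> nW (I s x - I a x) <= M.

(** The covariance of [I a x] and [I s x] only depends on [s - a], so strong
    continuity at 0 gives uniform continuity of the path [s |-> I s x]. *)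
Let osc_ex x M : 0 < M -> exists2 u0, 0 < u0 & forall u, u < u0 -> osc x u M.
Proof.
move=> M0; have c0 : 0 < 2 * nV x + 1 by have := snorm_ge0 dV x; lra.
have [|r0 r00 H] := P_cont x (e := M ^+ 2 / (2 * nV x + 1)).
  by rewrite divr_gt0// exprn_gt0.
exists r0 => // u ur a s a0 /andP[as_ sa].
have [->|sa'] := eqVneq s a; first by rewrite subrr (snorm0 hW) ltW.
have r1 : 0 < s - a < r0.
  by rewrite subr_gt0 lt_neqAle eq_sym sa' as_/=; apply: le_lt_trans ur; rewrite lerBlDl.
rewrite -ler_sqr ?nnegrE ?snorm_ge0 ?(ltW M0)//.
rewrite (sqr_snorm hW) (siBl hW) !(siB hW) !I_iso// ?(le_trans a0)//.
rewrite (siC hW (I s x)) -(subrK a s) (addrC _ a).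
rewrite stationary ?subr_ge0// -U_adj.
have -> : dV x x - dV x (U (I (s - a) x)) - (dV x (U (I (s - a) x)) - dV x x)
    = 2 * dV x (x - P (s - a) x) by rewrite (siB hV) /P; ring.
have h1 := le_trans (ler_norm _) (cauchy_schwarz hV x (x - P (s - a) x)).
have h2 := H _ r1; rewrite (snorm_distC hV) in h2.
have h3 : nV x * nV (x - P (s - a) x) <= nV x * (M ^+ 2 / (2 * nV x + 1)).
  by rewrite ler_wpM2l// snorm_ge0.
apply: (@le_trans _ _ (2 * nV x / (2 * nV x + 1) * M ^+ 2)).
  by apply: (@le_trans _ _ (2 * (nV x * (M ^+ 2 / (2 * nV x + 1)))));
    [lra|rewrite le_eqVlt; apply/orP; left; apply/eqP; field; lra].
by rewrite ger_pMl ?exprn_gt0// ler_pdivrMr// mul1r; lra.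
Qed.

Let mesh x t M : 0 < M -> 0 <= t ->
  exists N, forall n, (N < n)%N -> osc x (t / n%:R) M.
Proof.
move=> M0 t0; have [u0 u00 H] := osc_ex x M0.
exists (Num.truncn (t / u0)) => n Nn; apply: H.
have n0 : 0 < n%:R :> R by rewrite ltr0n (leq_ltn_trans _ Nn).
rewrite ltr_pdivrMr// mulrC -ltr_pdivrMr//.
apply: (lt_le_trans (truncnS_gt _)).
by rewrite ler_nat.
Qed.

(** Left Riemann sums with [n] steps of length [u], in [W] and in [V]. *)
Let TS a u n x := u *: \sum_(k < n) I (a + k%:R * u) x.
Let RS a u n x := u *: \sum_(k < n) P (a + k%:R * u) x.

Let adj_RS a u n x : adj (RS a u n x) (TS a u n x).
Proof.
move=> h; rewrite (siZ hV) (siZ hW) (si_sum hV) (si_sum hW).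
by congr (_ * _); apply: eq_bigr => k _; exact: U_adj.
Qed.

Let Z_riemann a u n x M : 0 <= a -> 0 <= u -> 0 <= M -> osc x u M ->
  nW (Z a (a + n%:R * u) x - TS a u n x) <= n%:R * u * M.
Proof.
move=> a0 u0 M0 H; elim: n => [|n IH].
  rewrite /TS big_ord0 scaler0 subr0 !mul0r addr0.
  have := Z_loc (x := x) a0 (lexx a) (lexx 0); rewrite subrr scale0r subr0 mul0r; apply.
  by move=> s /le_anti <-; rewrite subrr (snorm0 hW).
rewrite /TS big_ord_recr/= scalerDr -/(TS a u n x).
set b := a + n%:R * u in IH *; set c := a + _ * u.
have bc : c - b = u by rewrite /c /b -natr1; ring.
have ab : a <= b by rewrite lerDl mulr_ge0.
have bc' : b <= c by rewrite -subr_ge0 bc.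
have <- : nW (Z a b x + Z b c x - (TS a u n x + u *: I b x))
   = nW (Z a c x - (TS a u n x + u *: I b x)).
  by apply/(weq_snorm hW)/(weqB hW)/Z_add.
rewrite opprD addrACA; apply: (le_trans (snormD hW _ _)).
have -> : n.+1%:R * u * M = n%:R * u * M + u * M by rewrite -natr1; ring.
apply: lerD => //; rewrite -bc; apply: Z_loc => //; first exact: le_trans ab.
move=> s /andP[bs sc]; apply: H; first exact: le_trans ab.
by rewrite bs -bc addrC subrK.
Qed.

(** The integral of [P s x] over [s] between [a] and [b]. *)
Let S a b x := U (Z a b x).

Let S_riemann a u n x M : 0 <= a -> 0 <= u -> 0 <= M -> osc x u M ->
  nV (S a (a + n%:R * u) x - RS a u n x) <= n%:R * u * M.
Proof.
move=> a0 u0 M0 H; apply: le_trans (Z_riemann n a0 u0 M0 H).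
by apply: adj_le => h; rewrite (siB hV) (siB hW) adj_RS U_adj.
Qed.

Let S_loc a b x M : 0 <= a -> a <= b -> 0 <= M -> osc x (b - a) M ->
  nV (S a b x - (b - a) *: P a x) <= (b - a) * M.
Proof.
move=> a0 ab M0 H; apply: (le_trans (adj_le (y := Z a b x - (b - a) *: I a x) _)).
  by move=> h; rewrite (siB hV) (siB hW) (siZ hV) (siZ hW) !U_adj.
by apply: Z_loc => // s asb; apply: H; rewrite // addrC subrK.
Qed.

Let S_add a b c x : 0 <= a -> a <= b -> b <= c ->
  weq dV (S a b x + S b c x) (S a c x).
Proof.
move=> a0 ab bc h; rewrite (siD hV) !U_adj -(siD hW).
exact: Z_add.
Qed.

Let divnK t n : (0 < n)%N -> n%:R * (t / n%:R) = t :> R.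
Proof. by move=> n0; rewrite mulrC divfK// pnatr_eq0 -lt0n. Qed.

(** [P r] commutes with the path integral because it commutes with its Riemann
    sums. *)
Let P_S r u x : 0 <= r -> 0 <= u -> weq dV (P r (S 0 u x)) (S r (r + u) x).
Proof.
move=> r0 u0; apply: (@snorm_lim0 _ _ _ hV _ _ (2 * u)) => e e0.
have [N /(_ N.+1 (ltnSn _))] := mesh x e0 u0.
set v := u / _ => H; have v0 : 0 <= v by rewrite divr_ge0.
have vu : N.+1%:R * v = u by rewrite divnK.
apply: (le_trans (snorm_trans hV (P r (RS 0 v N.+1 x)) _ _)).
have E : weq dV (P r (RS 0 v N.+1 x)) (RS r v N.+1 x).
  move=> h; rewrite P_Z !(siZ hV) (si_sum hV); congr (_ * _).
  have -> : dV h (P r (\sum_(k < N.+1) P (0 + k%:R * v) x)) =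
      \sum_(k < N.+1) dV h (P r (P (0 + k%:R * v) x)).
    elim/big_rec2: _ => [|i y1 y2 _ <-]; last by rewrite P_D (siD hV).
    by rewrite -(scale0r 0) P_Z (siZ hV) mul0r.
  by apply: eq_bigr => k _; rewrite semigroupP ?add0r// mulr_ge0.
rewrite (weq_snorm hV (weqB hV _ E)) (_ : 2 * u * e = u * e + u * e); last by ring.
apply: lerD.
  apply: (le_trans (P_lip _ _ r0)).
  by have := S_riemann N.+1 (lexx 0) v0 (ltW e0) H; rewrite add0r vu.
rewrite (snorm_distC hV).
by have := S_riemann N.+1 r0 v0 (ltW e0) H; rewrite vu.
Qed.

(** The pairs [(x, L x)] for the generator [L] of [P]. *)
Definition agen x y := forall e, 0 < e ->
  exists2 r0 : R, 0 < r0 & forall r, 0 < r < r0 -> nV (r^-1 *: (P r x - x) - y) <= e.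

Let agen0 : agen 0 0.
Proof.
move=> e e0; exists 1 => // r _.
rewrite !subr0 (@weq_snorm _ _ _ hV _ 0) ?(snorm0 hV) ?ltW//.
by move=> h; rewrite (siZ hV) -(scale0r 0) P_Z !(siZ hV) !mul0r mulr0.
Qed.

Let agenP a x y x' y' : agen x y -> agen x' y' -> agen (a *: x + x') (a *: y + y').
Proof.
move=> H H' e e0; have a0 : 0 < `|a| + 1 by have := normr_ge0 a; lra.
have [|r1 r10 H1] := H (e / 2 / (`|a| + 1)); first by rewrite !divr_gt0.
have [|r2 r20 H2] := H' (e / 2); first by rewrite divr_gt0.
exists (Num.min r1 r2); first by rewrite lt_min r10.
move=> r; rewrite lt_min => /and3P[r0 rr1 rr2].
have E : weq dV (r^-1 *: (P r (a *: x + x') - (a *: x + x')) - (a *: y + y'))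
   (a *: (r^-1 *: (P r x - x) - y) + (r^-1 *: (P r x' - x') - y')).
  move=> h; rewrite !(siD hV, siN hV, siZ hV) P_D (siD hV) P_Z !(siD hV, siN hV, siZ hV).
  by ring.
rewrite (weq_snorm hV E); apply: (le_trans (snormD hV _ _)).
rewrite (snormZ hV) (splitr e); apply: lerD; last by apply: H2; rewrite r0.
apply: (@le_trans _ _ (`|a| * (e / 2 / (`|a| + 1)))).
  by rewrite ler_wpM2l// H1// r0.
by rewrite mulrCA ger_pMr ?divr_gt0// ler_pdivrMr// mul1r; lra.
Qed.

Let P0 x : weq dV (P 0 x) x.
Proof. by move=> h; rewrite U_adj I_iso. Qed.

(** [P r (S 0 u x) - S 0 u x] telescopes into [S u (u + r) x - S 0 r x], two
   integrals over short intervals. *)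
Let agen_S u x : 0 <= u -> agen (S 0 u x) (P u x - x).
Proof.
move=> u0 e e0; have [|r0 r00 H] := osc_ex x (M := e / 2); first by rewrite divr_gt0.
exists r0 => // r /andP[r_gt0 rr].
have ur : 0 <= u + r by rewrite addr_ge0// ltW.
have E : weq dV (r^-1 *: (P r (S 0 u x) - S 0 u x) - (P u x - x))
   (r^-1 *: (S u (u + r) x - r *: P u x) - r^-1 *: (S 0 r x - r *: P 0 x)).
  move=> h; rewrite !(siB hV, siZ hV) P_S ?(ltW r_gt0)// P0.
  have := S_add x (lexx 0) u0 (ler_wpDr (ltW r_gt0) (lexx u)) h.
  have := S_add x (lexx 0) (ltW r_gt0) (ler_wpDr u0 (lexx r)) h.
  rewrite !(siD hV) (addrC u r) => <- /(canRL (addKr _)) ->.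
  by have r0' : r != 0 := lt0r_neq0 r_gt0; field.
rewrite (weq_snorm hV E); apply: (le_trans (snormB hV _ _)).
rewrite !(snormZ hV) gtr0_norm ?invr_gt0// -mulrDr ler_pdivrMl//.
rewrite (splitr e) mulrDr; apply: lerD.
  have := S_loc (a := u) (b := u + r) (x := x) (M := e / 2).
  rewrite (_ : u + r - u = r); last by ring.
  by apply => //; [rewrite lerDl ltW|rewrite divr_ge0// ltW|exact: H].
have := S_loc (a := 0) (b := r) (x := x) (M := e / 2).
rewrite subr0.
by apply => //; [rewrite ltW|rewrite divr_ge0// ltW|exact: H].
Qed.

Let agen_sum n (F G : 'I_n -> V) : (forall k, agen (F k) (G k)) ->
  agen (\sum_(k < n) F k) (\sum_(k < n) G k).
Proof.
move=> FG; elim/big_rec2: _ => [|i y1 y2 _ IH]; first exact: agen0.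
by rewrite -(scale1r (F i)) -(scale1r (G i)); exact: agenP.
Qed.

Variables (K : V -> Prop) (gamma : R).
Hypothesis K0 : K 0.
Hypothesis K_D : forall x y, K x -> K y -> K (x + y).
Hypothesis K_Z : forall (a : R) x, K x -> K (a *: x).
Hypothesis K_P : forall (t : R) x, 0 <= t -> K x -> K (P t x).
Hypothesis K_closed : forall x,
  (forall e : R, 0 < e -> exists2 y, K y & nV (y - x) <= e) -> K x.
Hypothesis gamma_gt0 : 0 < gamma.
Hypothesis gap_le : forall x y, K x -> agen x y -> gamma * nV x <= nV y.

Let K_sum n (F : 'I_n -> V) : (forall k, K (F k)) -> K (\sum_(k < n) F k).
Proof. by move=> H; elim/big_ind: _ => //; exact: K_D. Qed.

Let K_S u x : 0 <= u -> K x -> K (S 0 u x).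
Proof.
move=> u0 Kx; apply: K_closed => e e0.
have c0 : 0 < u + 1 by lra.
have M0 : 0 < e / (u + 1) by rewrite divr_gt0.
have [N /(_ N.+1 (ltnSn _)) H] := mesh x M0 u0.
exists (RS 0 (u / N.+1%:R) N.+1 x).
  by apply: K_Z; apply: K_sum => k; apply: K_P => //; rewrite add0r mulr_ge0 ?divr_ge0.
rewrite (snorm_distC hV).
have := S_riemann N.+1 (lexx 0) (divr_ge0 u0 (ler0n _ _)) (ltW M0) H.
rewrite add0r divnK// => /le_trans; apply.
by rewrite mulrCA ger_pMr// ler_pdivrMr// mul1r; lra.
Qed.

(** First use of the gap: [S 0 u x] is bounded uniformly in [u]. *)
Let S_bound u x : 0 <= u -> K x -> nV (S 0 u x) <= 2 * nV x / gamma.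
Proof.
move=> u0 Kx; rewrite ler_pdivlMr// mulrC.
apply: (le_trans (gap_le (K_S u0 Kx) (agen_S x u0))).
by apply: (le_trans (snormB hV _ _)); have := P_le x u0; lra.
Qed.

(** Riemann sums of the Cesaro mean of [u |-> S 0 u x] over [0, t]. Being
   finite sums of elements of the domain of the generator, they belong to it. *)
Let D t n x := n%:R^-1 *: \sum_(k < n) S 0 (k%:R * (t / n%:R)) x.

Let K_D_mean t n x : 0 <= t -> K x -> K (D t n x).
Proof.
move=> t0 Kx; apply: K_Z; apply: K_sum => k.
by apply: K_S => //; rewrite mulr_ge0 ?divr_ge0.
Qed.

Let agen_D t n x : 0 < t -> (0 < n)%N ->
  agen (D t n x) (t^-1 *: RS 0 (t / n%:R) n x - x).
Proof.
move=> t0 n0.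
have -> : t^-1 *: RS 0 (t / n%:R) n x - x =
    n%:R^-1 *: (\sum_(k < n) (P (k%:R * (t / n%:R)) x - x)) + 0.
  rewrite addr0 sumrB scalerBr sumr_const card_ord; congr (_ - _).
    rewrite scalerA mulrA mulVf ?lt0r_neq0// mul1r.
    by congr (_ *: _); apply: eq_bigr => k _; rewrite add0r.
  by rewrite -[x *+ n]scaler_nat scalerA mulVf ?scale1r// pnatr_eq0 -lt0n.
rewrite -[D t n x]addr0; apply: agenP agen0.
by apply: agen_sum => k; apply: agen_S; rewrite mulr_ge0 ?divr_ge0 ?(ltW t0).
Qed.

Let RS_bound t n x M : 0 < t -> (0 < n)%N -> 0 <= M -> K x -> osc x (t / n%:R) M ->
  nV (t^-1 *: RS 0 (t / n%:R) n x) <= 2 * nV x / gamma / t + M.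
Proof.
move=> t0 n0 M0 Kx H; rewrite (snormZ hV) gtr0_norm ?invr_gt0// ler_pdivrMl//.
have -> : t * (2 * nV x / gamma / t + M) = t * M + 2 * nV x / gamma.
  by field; rewrite !lt0r_neq0.
apply: le_trans (lerD _ (S_bound (ltW t0) Kx)).
  by rewrite -[X in nV X](subrK (S 0 t x)); exact: (snormD hV).
rewrite (snorm_distC hV).
have := S_riemann n (lexx 0) (divr_ge0 (ltW t0) (ler0n _ _)) M0 H.
by rewrite add0r divnK.
Qed.

(** Reversing time in the covariances [dW (I (j u) x) (I (k u) x)] turns the
    square of a Riemann sum into twice the pairing of [x] with its partial sums,
    up to the diagonal terms. *)
Let TS_sqr u n x : 0 <= u ->
  `|nW (TS 0 u n x) ^+ 2 - 2 * u * \sum_(k < n) dW (I 0 x) (TS 0 u k x)|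
    <= 5 * n%:R * u ^+ 2 * nV x ^+ 2.
Proof.
move=> u0; elim: n => [|n IH].
  rewrite big_ord0 /TS big_ord0 scaler0 (snorm0 hW) expr0n mulr0 subrr normr0.
  by rewrite mulr0 !mul0r.
have tsS : TS 0 u n.+1 x = TS 0 u n x + u *: I (n%:R * u) x.
  by rewrite /TS big_ord_recr/= add0r scalerDr.
rewrite big_ord_recr/= tsS (sqr_snormD hW) nI ?mulr_ge0//.
have cs (k : nat) : `|dW (I 0 x) (I (k%:R * u) x)| <= nV x ^+ 2.
  by apply: (le_trans (cauchy_schwarz hW _ _)); rewrite !nI ?mulr_ge0// expr2.
have rev : dW (TS 0 u n x) (I (n%:R * u) x) = dW (I 0 x) (TS 0 u n x)
    + u * (dW (I 0 x) (I (n%:R * u) x) - dW (I 0 x) (I 0 x)).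
  rewrite /TS (siZl hW) (siZ hW) -mulrDr; congr (_ * _).
  rewrite (siC hW) !(si_sum hW).
  transitivity (\sum_(k < n) dW (I 0 x) (I (k.+1%:R * u) x)).
    rewrite (reindex_inj rev_ord_inj)/=; apply: eq_bigr => k _.
    rewrite (siC hW) add0r -(stationary _ _ (s := (n - k.+1)%:R * u)) ?mulr_ge0//.
    by rewrite -mulrDl -natrD subnK.
  under [in RHS]eq_bigr do rewrite add0r.
  have := telescope_sumr (fun k => dW (I 0 x) (I (k%:R * u) x)) (leq0n n).
  by rewrite big_mkord sumrB mul0r => /(canRL (subrK _)) ->; rewrite addrC.
have := cs n; have := cs 0; rewrite mul0r rev => /ler_normlP[b1 b2] /ler_normlP[b3 b4].
move: IH; set A := nW _ ^+ 2; set B := \sum_(k < n) _; set c := dW (I 0 x) (TS _ _ _ _).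
set c0 := dW (I 0 x) (I 0 x) in b1 b2 *; set cn := dW (I 0 x) (I _ x) in b3 b4 *.
have u2 : 0 <= u ^+ 2 by rewrite exprn_ge0.
have d1 : u ^+ 2 * (cn - c0) <= u ^+ 2 * (2 * nV x ^+ 2) by rewrite ler_wpM2l//; lra.
have d2 : u ^+ 2 * - (cn - c0) <= u ^+ 2 * (2 * nV x ^+ 2) by rewrite ler_wpM2l//; lra.
have nx2 : 0 <= u ^+ 2 * nV x ^+ 2 by rewrite mulr_ge0 ?exprn_ge0 ?snorm_ge0.
by rewrite -natr1 => /ler_normlP[e1 e2]; apply/ler_normlP; split; lra.
Qed.

(** Riemann sum version of [E |Z_t|^2 = 2 t <x, A_t x>]; the right-hand side
   tends to 0 with the mesh. *)
Let second_moment t n x M : 0 < t -> (0 < n)%N -> 0 <= M -> osc x (t / n%:R) M ->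
  `|nW (Z 0 t x) ^+ 2 / t - 2 * dV x (D t n x)|
    <= t * (4 * nV x * M + M ^+ 2) + 5 * (t / n%:R) * nV x ^+ 2.
Proof.
move=> t0 n0 M0 H; set u := t / n%:R.
have u0 : 0 <= u by rewrite divr_ge0// ltW.
have nu : n%:R * u = t by rewrite divnK.
have n0R : 0 < n%:R :> R by rewrite ltr0n.
have zr (k : nat) : (k <= n)%N -> nW (Z 0 (k%:R * u) x - TS 0 u k x) <= t * M.
  move=> kn; have := Z_riemann k (lexx 0) u0 M0 H; rewrite add0r => /le_trans; apply.
  by rewrite ler_wpM2r// -nu ler_wpM2r// ler_nat.
have zt := zr _ (leqnn n); rewrite nu in zt.
have tsn : nW (TS 0 u n x) <= t * nV x.
  have -> : t * nV x = u * (n%:R * nV x) by rewrite -nu; ring.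
  rewrite /TS (snormZ hW) ger0_norm// ler_wpM2l//.
  have : forall m, nW (\sum_(k < m) I (0 + k%:R * u) x) <= m%:R * nV x.
    elim=> [|m IH]; first by rewrite big_ord0 mul0r (snorm0 hW).
    rewrite big_ord_recr/=; apply: (le_trans (snormD hW _ _)).
    by rewrite -natr1 mulrDl mul1r lerD// nI// add0r mulr_ge0.
  exact.
have a1 : `|nW (Z 0 t x) ^+ 2 - nW (TS 0 u n x) ^+ 2|
    <= t * M * (2 * (t * nV x) + t * M).
  have b1 := snormD hW (Z 0 t x - TS 0 u n x) (TS 0 u n x); rewrite subrK in b1.
  have b2 := snormD hW (TS 0 u n x - Z 0 t x) (Z 0 t x).
  rewrite subrK (snorm_distC hW) in b2.
  rewrite subr_sqr normrM; apply: ler_pM => //.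
    by apply/ler_normlP; split; lra.
  by rewrite ger0_norm ?addr_ge0 ?snorm_ge0//; lra.
have a2 : `|u * \sum_(k < n) dW (I 0 x) (TS 0 u k x) - t * dV x (D t n x)|
    <= t * (t * (M * nV x)).
  rewrite (siZ hV) (si_sum hV) (mulrA t n%:R^-1) -/u -mulrBr normrM ger0_norm//.
  have -> : t * (t * (M * nV x)) = u * (n%:R * (t * (M * nV x))).
    by rewrite [RHS]mulrA (mulrC u) nu.
  rewrite ler_wpM2l// -sumrB.
  apply: (le_trans (ler_norm_sum _ _ _)).
  apply: (@le_trans _ _ (\sum_(k < n) (t * (M * nV x)))); last first.
    by rewrite sumr_const card_ord mulr_natl.
  apply: ler_sum => k _; rewrite U_adj -(siB hW) -/u.
  have -> : t * (M * nV x) = nV x * (t * M) by ring.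
  apply: (le_trans (cauchy_schwarz hW _ _)); rewrite nI// ler_wpM2l ?snorm_ge0//.
  by rewrite (snorm_distC hW) zr// ltnW.
have a3 := TS_sqr n x u0.
have -> : nW (Z 0 t x) ^+ 2 / t - 2 * dV x (D t n x) =
  (nW (Z 0 t x) ^+ 2 - 2 * (t * dV x (D t n x))) / t by field; exact: lt0r_neq0.
rewrite normrM [`|t^-1|]gtr0_norm ?invr_gt0// ler_pdivrMr//.
have e3 : 5 * n%:R * u ^+ 2 * nV x ^+ 2 = 5 * u * nV x ^+ 2 * t.
  by rewrite -[X in _ = _ * X]nu; ring.
rewrite e3 in a3.
move: a1 a2 a3 => /ler_normlP[? ?] /ler_normlP[? ?] /ler_normlP[? ?].
by apply/ler_normlP; split; lra.
Qed.

Let smallness x t (e : R) : 0 < e -> 0 < t -> exists M N, [/\ 0 < M, M <= e &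
  forall n, (N < n)%N -> osc x (t / n%:R) M /\
   t * (4 * nV x * M + M ^+ 2) + 5 * (t / n%:R) * nV x ^+ 2 <= e].
Proof.
move=> e0 t0; have nx := snorm_ge0 dV x.
set c := t * (4 * nV x + 1) + 1.
have c0 : 0 < c by rewrite /c ltr_wpDl// mulr_ge0 ?(ltW t0)//; lra.
set M := Num.min 1 (Num.min e (e / 2 / c)).
have M0 : 0 < M by rewrite /M !lt_min ltr01 e0 !divr_gt0.
have M1 : M <= 1 by rewrite /M ge_min lexx.
have Me : M <= e by rewrite /M !ge_min lexx orbT.
have Mc : M * c <= e / 2 by rewrite -ler_pdivlMr// /M !ge_min lexx !orbT.
have [N1 HN] := mesh x M0 (ltW t0).
pose q := 5 * t * nV x ^+ 2; have q0 : 0 <= q by rewrite /q !mulr_ge0 ?exprn_ge0 ?(ltW t0).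
exists M, (maxn N1 (Num.truncn (q / (e / 2)))); split => // n; rewrite gtn_max => /andP[n1 n2].
split; first exact: HN.
have n0 : 0 < n%:R :> R by rewrite ltr0n (leq_ltn_trans _ n1).
have l1 : t * (4 * nV x * M + M ^+ 2) <= M * c.
  have : t * M ^+ 2 <= t * M by rewrite ler_pM2l// expr2 ler_piMl// ltW.
  by rewrite /c; lra.
have l2 : 5 * (t / n%:R) * nV x ^+ 2 <= e / 2.
  have -> : 5 * (t / n%:R) * nV x ^+ 2 = q / n%:R by rewrite /q; ring.
  rewrite ler_pdivrMr// mulrC -ler_pdivrMr ?divr_gt0//.
  by apply: (le_trans (ltW (truncnS_gt _))); rewrite ler_nat.
by rewrite (splitr e); lra.
Qed.

(** The generator maps the difference of the Cesaro means at times [t] and [s] to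
    [S 0 t x / t - S 0 s x / s], since the two terms [- x] cancel; the gap then
    bounds this difference by [2 |x| / gamma^2 * (1/t + 1/s)], and pairing with
    [2 x] gives the constant 4. *)
Lemma second_moment_cauchy x s t : K x -> 0 < s -> 0 < t ->
  `|nW (Z 0 t x) ^+ 2 / t - nW (Z 0 s x) ^+ 2 / s|
    <= 4 / gamma ^+ 2 * nV x ^+ 2 * (t^-1 + s^-1).
Proof.
move=> Kx s0 t0; have nx := snorm_ge0 dV x.
have g0 : 0 < gamma^-1 by rewrite invr_gt0.
apply/ler_addgt0Pr => e0 e00.
set c := 2 + 4 * nV x / gamma.
have c0 : 0 < c by rewrite /c ltr_wpDr// divr_ge0 ?mulr_ge0// ltW.
pose e := e0 / c; have e_gt0 : 0 < e by rewrite divr_gt0.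
have ec : e * c = e0 by rewrite /e divfK// lt0r_neq0.
have [M [N [M0 Me H]]] := smallness x e_gt0 t0.
have [m [n [m0 me Hs]]] := smallness x e_gt0 s0.
have [hosc1 b1] := H N.+1 (ltnSn _); have [hosc2 b2] := Hs n.+1 (ltnSn _).
have v1 := le_trans (second_moment t0 (ltn0Sn N) (ltW M0) hosc1) b1.
have v2 := le_trans (second_moment s0 (ltn0Sn n) (ltW m0) hosc2) b2.
have r1 := RS_bound t0 (ltn0Sn N) (ltW M0) Kx hosc1.
have r2 := RS_bound s0 (ltn0Sn n) (ltW m0) Kx hosc2.
(* Second use of the gap, for the difference of two Cesaro means. *)
have d : gamma * nV (D t N.+1 x - D s n.+1 x) <=
     2 * nV x / gamma * (t^-1 + s^-1) + 2 * e.
  have G := agenP (-1) (agen_D x s0 (ltn0Sn n)) (agen_D x t0 (ltn0Sn N)).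
  have KD := K_D (K_Z (-1) (K_D_mean n.+1 (ltW s0) Kx)) (K_D_mean N.+1 (ltW t0) Kx).
  have := gap_le KD G; rewrite !scaleN1r (addrC (- D s _ _)) => /le_trans; apply.
  rewrite opprB addrC addrA subrK; apply: (le_trans (snormB hV _ _)).
  by rewrite mulrDr; lra.
have d' : `|dV x (D t N.+1 x) - dV x (D s n.+1 x)| <=
     nV x * (gamma^-1 * (2 * nV x / gamma * (t^-1 + s^-1) + 2 * e)).
  rewrite -(siB hV); apply: (le_trans (cauchy_schwarz hV _ _)).
  by rewrite ler_wpM2l// ler_pdivlMl.
have E : nV x * (gamma^-1 * (2 * nV x / gamma * (t^-1 + s^-1) + 2 * e)) =
   2 / gamma ^+ 2 * nV x ^+ 2 * (t^-1 + s^-1) + 2 * nV x / gamma * e.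
  by field; rewrite !lt0r_neq0.
rewrite E in d'.
move: v1 v2 d' => /ler_normlP[? ?] /ler_normlP[? ?] /ler_normlP[? ?].
by apply/ler_normlP; rewrite -ec /c; split; lra.
Qed.

End AbstractProcess.

(** * Integration against a mixture of measures *)

Section Mixture.
Context d1 d2 (T : measurableType d1) (T' : measurableType d2) (R : realType).
Variables (nu : {measure set T -> \bar R}) (m : {measure set T' -> \bar R}).
Variable k : T' -> {measure set T -> \bar R}.
Hypothesis mk : forall A, measurable A -> measurable_fun setT (k ^~ A).
Hypothesis nuE : forall A, measurable A -> nu A = \int[m]_w k w A.

Import HBNNSimple.

Let integral_mixture_nnsfun (h : {nnsfun T >-> R}) :
  \int[nu]_x (h x)%:E = \int[m]_w \int[k w]_x (h x)%:E.
Proof.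
rewrite integralT_nnsfun.
under [RHS]eq_integral do rewrite integralT_nnsfun sintegralE.
rewrite ge0_integral_fsum//; last 2 first.
  by move=> r; apply: measurable_funeM; exact: mk.
  by move=> n x _; exact: nnsfun_mulemu_ge0.
rewrite sintegralE; apply: eq_fsbigr => // r rh.
have [r0|r0] := leP 0%R r.
  by rewrite ge0_integralZl//; [rewrite nuE|exact: mk].
rewrite preimage_nnfun0// measure0 mule0 integral0_eq// => w _.
by rewrite measure0 mule0.
Qed.

Lemma ge0_integral_mixture (h : T -> \bar R) :
  measurable_fun setT h -> (forall x, 0 <= h x) ->
  \int[nu]_x h x = \int[m]_w \int[k w]_x h x.
Proof.
move=> mh h0.
pose g := nnsfun_approx measurableT mh.
have mg n : measurable_fun [set: T] (EFin \o g n) by exact/measurable_EFinP.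
have g0 n x : 0 <= (g n x)%:E by rewrite lee_fin.
have nd_g x : {homo (fun n => (g n x)%:E) : i j / (i <= j)%N >-> i <= j}.
  by move=> i j ij; rewrite lee_fin; exact/lefP/nd_nnsfun_approx.
have gh x : limn (fun n => (g n x)%:E) = h x.
  by apply/cvg_lim => //; exact: cvg_nnsfun_approx.
have mono (m' : {measure set T -> \bar R}) :
    \int[m']_x h x = limn (fun n => \int[m']_x (g n x)%:E).
  under eq_integral do rewrite -gh.
  by rewrite monotone_convergence.
rewrite mono; under eq_fun do rewrite integral_mixture_nnsfun.
under [RHS]eq_integral do rewrite mono.
rewrite monotone_convergence//.
- move=> n; apply: measurable_fun_integral_kernel => //; exact: mg.
- by move=> n w _; exact: integral_ge0.
- move=> w _ i j ij; apply: ge0_le_integral => //; [exact: mg..|].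
  by move=> x _; exact: nd_g.
Qed.

(** The inner integral may be infinite or undefined for [w] in a null set, where
    [Rintegral] takes a junk value; hence the detour through the positive and
    negative parts of [h], whose mixtures are finite almost everywhere. *)
Lemma Rintegral_mixture (h : T -> R) : nu.-integrable setT (EFin \o h) ->
  m.-integrable setT (fun w => (\int[k w]_x h x)%R%:E) /\
  (\int[nu]_x h x = \int[m]_w (\int[k w]_x h x))%R.
Proof.
move=> hi; have mh := measurable_int _ hi.
pose F (u : T -> \bar R) w := \int[k w]_x u x.
have mF u : measurable_fun setT u -> (forall x, 0 <= u x) ->
    measurable_fun setT (F u) by move=> mu u0; apply: measurable_fun_integral_kernel.
have iF u : nu.-integrable setT u -> (forall x, 0 <= u x) -> m.-integrable setT (F u).
  move=> ui u0; have mu := measurable_int _ ui.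
  apply/integrableP; split; first exact: mF.
  under eq_integral => w _ do rewrite gee0_abs ?integral_ge0//.
  rewrite -ge0_integral_mixture//; have /integrableP[_] := ui.
  by under eq_integral => w _ do rewrite gee0_abs//.
have ip := iF _ (integrable_funepos measurableT hi) (fun x => funepos_ge0 _ x).
have iN := iF _ (integrable_funeneg measurableT hi) (fun x => funeneg_ge0 _ x).
have iB := integrableB measurableT ip iN.
have EB w : (F (EFin \o h)^\+ \- F (EFin \o h)^\-) w = \int[k w]_x (h x)%:E.
  by rewrite [RHS]integralE.
have aeE : {ae m, forall w, setT w ->
   (F (EFin \o h)^\+ \- F (EFin \o h)^\-) w = (\int[k w]_x h x)%R%:E}.
  have := integrable_ae measurableT iB; apply: filterS => w /(_ I) fw _.
  by rewrite /Rintegral -EB fineK.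
have mR : measurable_fun setT (fun w => (\int[k w]_x h x)%R%:E).
  apply/measurable_EFinP; rewrite /Rintegral.
  apply: (@measurableT_comp _ _ _ _ _ _ fine); first exact: fine_measurable.
  rewrite (_ : (fun w => _) = F (EFin \o h)^\+ \- F (EFin \o h)^\-).
    by have := measurable_int _ iB.
  by apply/funext => w; rewrite EB.
split.
  apply: (le_integrable measurableT mR _ iB) => w _; rewrite EB /Rintegral.
  by case: (\int[k w]_x (h x)%:E) => [r| |]//=; rewrite normr0 leey.
rewrite /Rintegral; congr fine.
rewrite integralE !ge0_integral_mixture//; last 2 first.
- exact: measurable_funeneg.
- exact: measurable_funepos.
rewrite -integralB//; apply: ae_eq_integral => //.
by have := measurable_int _ iB.
Qed.

End Mixture.

(** * Complex square-integrable functions *)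

Section SquareIntegrable.
Context d (T : measurableType d) (R : realType).
Implicit Types (m : {measure set T -> \bar R}) (f g : T -> R[i]).
Local Open Scope ring_scope.

(** The real part of [y^* z]. *)
Definition rdot (y z : R[i]) : R :=
  complex.Re y * complex.Re z + complex.Im y * complex.Im z.

Lemma rdot_ge0 z : 0 <= rdot z z.
Proof. by rewrite /rdot -!expr2 addr_ge0// sqr_ge0. Qed.

Lemma rdot_le y z : `|rdot y z| <= rdot y y + rdot z z.
Proof.
case: y z => [a b] [c d']; rewrite /rdot/=.
have := sqr_ge0 (a - c); have := sqr_ge0 (b - d').
have := sqr_ge0 (a + c); have := sqr_ge0 (b + d').
have := sqr_ge0 a; have := sqr_ge0 b; have := sqr_ge0 c; have := sqr_ge0 d'.
by rewrite !expr2 => *; apply/ler_normlP; split; lra.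
Qed.

Lemma rdotD_le y z : rdot (y + z) (y + z) <= 2 * (rdot y y + rdot z z).
Proof.
case: y z => [a b] [c d']; rewrite /rdot/=.
have := sqr_ge0 (a - c); have := sqr_ge0 (b - d').
by rewrite !expr2 => *; lra.
Qed.

Lemma rdotDr x y z : rdot x (y + z) = rdot x y + rdot x z.
Proof. by case: x y z => [? ?] [? ?] [? ?]; rewrite /rdot/=; ring. Qed.

Lemma rdotZr x (a : R) (y : Rcomplex R) : rdot x (a *: y) = a * rdot x y.
Proof. by case: x y => [? ?] [? ?]; rewrite /rdot/=; ring. Qed.

Lemma sqr_normc (z : R[i]) : ComplexField.Normc.normc z ^+ 2 = rdot z z.
Proof. by case: z => a b; rewrite /rdot/= sqr_sqrtr ?addr_ge0 ?sqr_ge0// !expr2. Qed.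

Lemma measurable_rdot f g : cmeasurable f -> cmeasurable g ->
  measurable_fun setT (fun x => rdot (f x) (g x)).
Proof.
by move=> [? ?] [? ?]; apply: measurable_funD; apply: measurable_funM.
Qed.

Lemma normL2E m f : normL2 m f = sqrte (\int[m]_x (rdot (f x) (f x))%:E).
Proof.
rewrite /normL2 unlock -poweR12_sqrt; last first.
  by apply: integral_ge0 => x _; rewrite lee_fin rdot_ge0.
congr (_ `^ _)%E; apply: eq_integral => x _.
rewrite /=; congr EFin.
by rewrite powR_mulrn// real_normK ?num_real// sqr_normc.
Qed.

Lemma L2P m f :
  L2 m f <-> cmeasurable f /\ (\int[m]_x (rdot (f x) (f x))%:E < +oo)%E.
Proof.
rewrite /L2/= normL2E; have : (0 <= \int[m]_x (rdot (f x) (f x))%:E)%E.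
  by apply: integral_ge0 => x _; rewrite lee_fin rdot_ge0.
by case: (\int[m]_x _)%E => //= r _; rewrite !ltry.
Qed.

Lemma L2_integrable m f : L2 m f ->
  m.-integrable setT (fun x => (rdot (f x) (f x))%:E).
Proof.
move=> /L2P[mf fi]; apply/integrableP; split.
  by apply/measurable_EFinP; exact: measurable_rdot.
by under eq_integral => x _ do rewrite gee0_abs ?lee_fin ?rdot_ge0//.
Qed.

Lemma L2_integrable_rdot m f g : L2 m f -> L2 m g ->
  m.-integrable setT (fun x => (rdot (f x) (g x))%:E).
Proof.
move=> Hf Hg; have [mf _] := Hf; have [mg _] := Hg.
have := integrableD measurableT (L2_integrable Hf) (L2_integrable Hg).
apply: le_integrable => //; first by apply/measurable_EFinP; exact: measurable_rdot.
move=> x _; rewrite /= lee_fin.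
by rewrite [leRHS]ger0_norm ?rdot_le// addr_ge0 ?rdot_ge0.
Qed.

Lemma cmeasurableD f g : cmeasurable f -> cmeasurable g ->
  cmeasurable (fun x => f x + g x).
Proof.
move=> [fr fi] [gr gi]; split.
  rewrite (_ : (fun x => _) = (fun x => complex.Re (f x) + complex.Re (g x))).
    exact: measurable_funD.
  by apply/funext => x; case: (f x); case: (g x).
rewrite (_ : (fun x => _) = (fun x => complex.Im (f x) + complex.Im (g x))).
  exact: measurable_funD.
by apply/funext => x; case: (f x); case: (g x).
Qed.

Lemma cmeasurableZ (a : R) f : cmeasurable f ->
  cmeasurable (fun x => a *: (f x : Rcomplex R)).
Proof.
move=> [fr fi]; split.
  rewrite (_ : (fun x => _) = (fun x => a * complex.Re (f x))).
    exact: measurable_funM.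
  by apply/funext => x; case: (f x).
rewrite (_ : (fun x => _) = (fun x => a * complex.Im (f x))).
  exact: measurable_funM.
by apply/funext => x; case: (f x).
Qed.

Lemma rdotZZ (a : R) (z : Rcomplex R) : rdot (a *: z) (a *: z) = a ^+ 2 * rdot z z.
Proof. by case: z => b c; rewrite /rdot/=; ring. Qed.

Definition L2pred m : {pred T -> Rcomplex R} := mem (L2 m : set (T -> Rcomplex R)).

Lemma L2pred_submod m : subsemimod_closed (L2pred m).
Proof.
have LD : {in L2pred m &, forall f g, f + g \in L2pred m}.
  move=> f g /set_mem Hf /set_mem Hg; apply/mem_set/L2P.
  split; first exact: (cmeasurableD Hf.1 Hg.1).
  have /integrableP[_ H] := integrableZl measurableT 2
    (integrableD measurableT (L2_integrable Hf) (L2_integrable Hg)).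
  apply: le_lt_trans H; apply: ge0_le_integral => //.
  - by move=> x _; rewrite lee_fin rdot_ge0.
  - apply/measurable_EFinP; have := cmeasurableD Hf.1 Hg.1.
    by move=> h; exact: (measurable_rdot h h).
  - apply/measurable_EFinP; apply: measurableT_comp => //.
    apply: measurable_funM => //; apply: measurable_funD.
      exact: (measurable_rdot Hf.1 Hf.1).
    exact: (measurable_rdot Hg.1 Hg.1).
  - move=> x _; rewrite /= lee_fin; apply: le_trans (ler_norm _).
    exact: rdotD_le.
have LZ (a : R) (u : T -> Rcomplex R) : u \in L2pred m -> a *: u \in L2pred m.
  move=> /set_mem Hu; apply/mem_set/L2P.
  split; first exact: (cmeasurableZ a Hu.1).
  under eq_integral => x _ do rewrite rdotZZ EFinM.
  have /integrableP[_] := integrableZl measurableT (a ^+ 2) (L2_integrable Hu).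
  by under eq_integral => x _ do
    rewrite gee0_abs ?mule_ge0 ?lee_fin ?sqr_ge0 ?rdot_ge0//.
have L0 : (0 : T -> Rcomplex R) \in L2pred m.
  apply/mem_set/L2P; split; first by split; exact: measurable_cst.
  by rewrite integral0_eq// => x _; rewrite /rdot/= mulr0 addr0.
by split.
Qed.

HB.instance Definition _ m := GRing.isSubmodClosed.Build R (T -> Rcomplex R)
  (L2pred m) (L2pred_submod m).

(** Square-integrable functions, not identified when equal almost everywhere, as
    a vector space over the reals: only real parts of scalar products matter
    for variances. *)
Record l2 m := MkL2 { l2fun : T -> Rcomplex R ; l2funP : l2fun \in L2pred m }.

HB.instance Definition _ m := [isSub for @l2fun m].
HB.instance Definition _ m := gen_eqMixin (l2 m).
HB.instance Definition _ m := gen_choiceMixin (l2 m).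
HB.instance Definition _ m := [SubChoice_isSubLmodule of l2 m by <:].

End SquareIntegrable.

Section L2Dot.
Context d (T : measurableType d) (R : realType) (m : {measure set T -> \bar R}).
Implicit Types f g h : l2 m.
Local Open Scope ring_scope.

Lemma l2P f : L2 m (l2fun f).
Proof. exact: set_mem (l2funP f). Qed.

Definition dot f g : R := \int[m]_x rdot (l2fun f x) (l2fun g x).

Let int_rdot f g : m.-integrable setT (EFin \o (fun x => rdot (l2fun f x) (l2fun g x))).
Proof. exact: L2_integrable_rdot (l2P f) (l2P g). Qed.

Lemma dot_semi_inner : semi_inner dot.
Proof.
split.
- by move=> f g; apply: eq_Rintegral => x _; rewrite /rdot; ring.
- move=> f g h; rewrite -RintegralD//; apply: eq_Rintegral => x _.
  exact: rdotDr.
- move=> f a g; rewrite -RintegralZl//; apply: eq_Rintegral => x _.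
  exact: rdotZr.
- by move=> f; apply: Rintegral_ge0 => x _; exact: rdot_ge0.
Qed.

Lemma normL2_snorm f : normL2 m (l2fun f) = (snorm dot f)%:E.
Proof.
rewrite normL2E /snorm /dot /Rintegral.
have := integrable_fin_num measurableT (int_rdot f f).
by move/fineK => {1}<-.
Qed.

Lemma snorm_ae f g : {ae m, forall x, l2fun f x = l2fun g x} -> weq dot f g.
Proof.
move=> fg h; rewrite /dot /Rintegral; congr fine; apply: ae_eq_integral => //.
- by have := measurable_int _ (int_rdot h f).
- by have := measurable_int _ (int_rdot h g).
- by apply: filterS fg => x -> _.
Qed.

End L2Dot.

Section Jensen.
Context d (T : measurableType d) (R : realType) (m : {measure set T -> \bar R}).
Variables (D : set T) (c : R).
Hypotheses (mD : measurable D) (mDc : m D = c%:E).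

Let int_cst (a : R) : m.-integrable D (EFin \o cst a).
Proof.
apply/integrableP; split; first exact: (measurable_cst a%:E).
rewrite (eq_integral (cst `|a|%:E))//.
by rewrite integral_cst//= mDc -EFinM ltry.
Qed.

Lemma sqr_integrable (f : T -> R) : measurable_fun D f ->
  \int[m]_(x in D) ((f x) ^+ 2)%:E < +oo -> m.-integrable D (EFin \o f).
Proof.
move=> mf f2.
have if2 : m.-integrable D (fun x => ((f x) ^+ 2)%:E).
  apply/integrableP; split; first by apply/measurable_EFinP; exact: measurable_funX.
  by under eq_integral => x _ do rewrite gee0_abs ?lee_fin ?sqr_ge0//.
have := integrableD mD (int_cst 1%R) if2.
apply: le_integrable => //; first exact/measurable_EFinP.
move=> x _; rewrite /= lee_fin; apply: le_trans (ler_norm _).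
have := sqr_ge0 (f x - 1); have := sqr_ge0 (f x + 1); have := sqr_ge0 (f x).
by rewrite !expr2 => ? ? ?; apply/ler_normlP; split; lra.
Qed.

(** Jensen's inequality, from the positivity of the integral of [(c f - a)^2]
    with [a] the integral of [f]. When the right-hand side is finite, [f] is
    integrable. *)
Lemma sqr_Rintegral_le (f : T -> R) : measurable_fun D f ->
  (((\int[m]_(x in D) f x)%R ^+ 2)%:E <= c%:E * \int[m]_(x in D) ((f x) ^+ 2)%:E).
Proof.
move=> mf.
have c0 : (0 <= c)%R by rewrite -lee_fin -mDc.
have f2_ge0 : 0 <= \int[m]_(x in D) ((f x) ^+ 2)%:E.
  by apply: integral_ge0 => x _; rewrite lee_fin sqr_ge0.
have [c00|cn0] := eqVneq c 0%R.
  have -> : (\int[m]_(x in D) f x)%R = 0%R.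
    rewrite /Rintegral null_set_integral// ?mDc ?c00//.
    exact/measurable_EFinP.
  by rewrite expr0n/= mule_ge0// lee_fin.
have cp : (0 < c)%R by rewrite lt_def cn0.
have [foo|] := ltP (\int[m]_(x in D) ((f x) ^+ 2)%:E) +oo; last first.
  by rewrite leye_eq => /eqP ->; rewrite gt0_muley ?lte_fin// leey.
have fi := sqr_integrable mf foo.
have if2 : m.-integrable D (EFin \o (fun x => (f x) ^+ 2)%R).
  apply/integrableP; split; first by apply/measurable_EFinP; exact: measurable_funX.
  by under eq_integral => x _ do rewrite gee0_abs ?lee_fin ?sqr_ge0//.
have := integrable_fin_num mD if2 => /fineK <-.
rewrite -EFinM lee_fin -/(Rintegral _ _ _).
set a := Rintegral _ _ _; set b := Rintegral _ _ _.
have : (0 <= \int[m]_(x in D) (c * f x - a) ^+ 2)%R.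
  by apply: Rintegral_ge0 => x _; exact: sqr_ge0.
have -> : (\int[m]_(x in D) (c * f x - a) ^+ 2 = c ^+ 2 * b + (- 2 * c * a) * a + a ^+ 2 * c)%R.
  transitivity (\int[m]_(x in D) (c ^+ 2 * (f x ^+ 2) + (- 2 * c * a) * f x + a ^+ 2))%R.
    by apply: eq_Rintegral => x _; ring.
  rewrite RintegralD//; last 2 first.
  - exact: (integrableD mD (integrableZl mD (c ^+ 2) if2)
      (integrableZl mD (- 2 * c * a)%R fi)).
  - exact: int_cst.
  rewrite RintegralD//; last 2 first.
  - exact: (integrableZl mD (c ^+ 2) if2).
  - exact: (integrableZl mD (- 2 * c * a)%R fi).
  by rewrite Rintegral_cst// mDc !RintegralZl.
have -> : (c ^+ 2 * b + - 2 * c * a * a + a ^+ 2 * c = c * (c * b - a ^+ 2))%R by ring.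
by rewrite pmulr_rge0// subr_ge0.
Qed.

End Jensen.

(** * Integrals along a measurable path *)

Section PathIntegral.
Context dO (Omega : measurableType dO) (R : realType).
Variable m : {sigma_finite_measure set Omega -> \bar R}.
Local Notation leb := (@lebesgue_measure R).
Variables a b : R.

Section Real.
Variable V : R * Omega -> R.
Hypothesis mV : measurable_fun setT V.

(* Fubini's theorem is applied on the whole line, to the restriction of [V] to
   the strip above [a, b]. *)
Let D : set (R * Omega) := `[a, b]%classic `*` setT.

Let mD : measurable D.
Proof. exact: measurableX. Qed.

Let mVD : measurable_fun setT (V \_ D).
Proof. exact/(measurable_restrictT _ mD)/measurable_funTS. Qed.

Let VDE w s : ((fun s => V (s, w)) \_ `[a, b]%classic) s = (V \_ D) (s, w).
Proof.
rewrite /patch; have -> : ((s, w) \in D) = (s \in `[a, b]%classic) => //.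
by apply/idP/idP => /set_mem h; apply/mem_set => //; case: h.
Qed.

Lemma measurable_path_integral :
  measurable_fun setT (fun w => (\int[leb]_(s in `[a, b]) V (s, w))%R).
Proof.
rewrite /Rintegral; apply: (@measurableT_comp _ _ _ _ _ _ fine).
  exact: fine_measurable.
rewrite (_ : (fun w => _) = fun w =>
    fubini_G leb (EFin \o (V \_ D))^\+ w - fubini_G leb (EFin \o (V \_ D))^\- w).
  apply: emeasurable_funB; apply: measurable_fun_fubini_tonelli_G => //.
  - by apply: measurable_funepos; exact/measurable_EFinP.
  - by apply: measurable_funeneg; exact/measurable_EFinP.
apply/funext => w; rewrite integral_mkcond.
have -> : (fun s => (V (s, w))%:E) \_ `[a, b]%classic = fun s => ((V \_ D) (s, w))%:E.
  by apply/funext => s; rewrite -VDE /patch; case: ifPn.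
rewrite integralE; congr (_ - _); apply: eq_integral => s _.
  by rewrite !funeposE.
by rewrite !funenegE.
Qed.

Let F sw := (((V \_ D) sw) ^+ 2)%:E.

Let mF : measurable_fun setT F.
Proof. by apply/measurable_EFinP; exact: measurable_funX. Qed.

Let sqr0 w s : ((fun s => ((V (s, w)) ^+ 2)%:E) \_ `[a, b]%classic) s = F (s, w).
Proof. by rewrite /F -VDE /patch; case: ifPn => //; rewrite expr0n. Qed.

Lemma path_integral_tonelli :
  \int[m]_w \int[leb]_(s in `[a, b]) ((V (s, w)) ^+ 2)%:E =
  \int[leb]_(s in `[a, b]) \int[m]_w ((V (s, w)) ^+ 2)%:E.
Proof.
transitivity (\int[m]_w \int[leb]_s F (s, w)).
  apply: eq_integral => w _; rewrite integral_mkcond.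
  by apply: eq_integral => s _; exact: sqr0.
rewrite -(@fubini_tonelli _ _ _ _ _ leb m F mF); last first.
  by move=> sw; rewrite lee_fin sqr_ge0.
rewrite [RHS]integral_mkcond; apply: eq_integral => s _.
rewrite /patch; case: ifPn => sab.
  by apply: eq_integral => w _; rewrite -sqr0 /patch sab.
by apply: integral0_eq => w _; rewrite -sqr0 /patch (negbTE sab).
Qed.

Let msqr : measurable_fun setT
  (fun w => \int[leb]_(s in `[a, b]) ((V (s, w)) ^+ 2)%:E).
Proof.
rewrite (_ : (fun w => _) = fubini_G leb F) //.
  by apply: measurable_fun_fubini_tonelli_G => // sw; rewrite lee_fin sqr_ge0.
apply/funext => w; rewrite integral_mkcond.
by apply: eq_integral => s _; exact: sqr0.
Qed.

Let mVw w : measurable_fun `[a, b]%classic (fun s => V (s, w)).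
Proof. by apply: measurable_funTS; exact: measurable_fun_pair1. Qed.

Let lebab : (a <= b)%R -> leb `[a, b]%classic = (b - a)%:E.
Proof.
by move=> ab; rewrite lebesgue_measure_itv/= lte_fin lt_neqAle ab andbT; case: eqVneq => // ->; rewrite subrr.
Qed.
Hypothesis ab : (a <= b)%R.

Lemma sqr_path_integral_le :
  \int[m]_w ((\int[leb]_(s in `[a, b]) V (s, w))%R ^+ 2)%:E <=
  (b - a)%:E * \int[leb]_(s in `[a, b]) \int[m]_w ((V (s, w)) ^+ 2)%:E.
Proof.
rewrite -path_integral_tonelli -ge0_integralZl//; last 2 first.
- by move=> w _; apply: integral_ge0 => s _; rewrite lee_fin sqr_ge0.
- by rewrite lee_fin subr_ge0.
apply: ge0_le_integral => //.
- by move=> w _; rewrite lee_fin sqr_ge0.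
- by apply/measurable_EFinP/measurable_funX; exact: measurable_path_integral.
- by apply: measurable_funeM; exact: msqr.
- move=> w _; apply: (sqr_Rintegral_le _ (lebab ab)); last exact: mVw.
  exact: measurable_itv.
Qed.

Lemma path_integrable_ae :
  \int[leb]_(s in `[a, b]) \int[m]_w ((V (s, w)) ^+ 2)%:E < +oo ->
  {ae m, forall w, leb.-integrable `[a, b] (EFin \o (fun s => V (s, w)))}.
Proof.
rewrite -path_integral_tonelli => foo.
have iF : m.-integrable setT (fun w => \int[leb]_(s in `[a, b]) ((V (s, w)) ^+ 2)%:E).
  apply/integrableP; split; first exact: msqr.
  rewrite (eq_integral (fun w => \int[leb]_(s in `[a, b]) ((V (s, w)) ^+ 2)%:E))//.
  by move=> w _; rewrite gee0_abs// integral_ge0// => s _; rewrite lee_fin sqr_ge0.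
have := integrable_ae measurableT iF; apply: filterS => w /(_ I) fw.
apply: (sqr_integrable _ (lebab ab)); [exact: measurable_itv|exact: mVw|].
by rewrite ltey_eq fw.
Qed.

End Real.
End PathIntegral.

(** * Laws of the Markov process *)

Section SameLaw.
Context d1 d2 d3 (T1 : measurableType d1) (T2 : measurableType d2)
  (T3 : measurableType d3) (R : realType).
Variables (m1 : {measure set T1 -> \bar R}) (m2 : {measure set T2 -> \bar R}).
Variables (phi1 : T1 -> T3) (phi2 : T2 -> T3).
Hypotheses (mphi1 : measurable_fun setT phi1) (mphi2 : measurable_fun setT phi2).
Hypothesis same_law : forall A, measurable A -> m1 (phi1 @^-1` A) = m2 (phi2 @^-1` A).

Lemma ge0_integral_same_law (h : T3 -> \bar R) :
  measurable_fun setT h -> (forall y, 0 <= h y) ->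
  \int[m1]_w h (phi1 w) = \int[m2]_w h (phi2 w).
Proof.
move=> mh h0.
have := @ge0_integral_pushforward _ _ _ _ _ _ mphi1 m1 setT h measurableT mh (fun y _ => h0 y).
rewrite preimage_setT => <-.
have := @ge0_integral_pushforward _ _ _ _ _ _ mphi2 m2 setT h measurableT mh (fun y _ => h0 y).
rewrite preimage_setT => <-.
by apply: eq_measure_integral => A mA _; exact: same_law.
Qed.

Lemma integral_same_law (h : T3 -> \bar R) : measurable_fun setT h ->
  \int[m1]_w h (phi1 w) = \int[m2]_w h (phi2 w).
Proof.
move=> mh; rewrite integralE [RHS]integralE; congr (_ - _).
- under eq_integral do rewrite -[_^\+ _]/(((h \o phi1)^\+) _) funepos_comp.
  under [RHS]eq_integral do rewrite -[_^\+ _]/(((h \o phi2)^\+) _) funepos_comp.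
  by apply: ge0_integral_same_law => //; exact: measurable_funepos.
- under eq_integral do rewrite -[_^\- _]/(((h \o phi1)^\-) _) funeneg_comp.
  under [RHS]eq_integral do rewrite -[_^\- _]/(((h \o phi2)^\-) _) funeneg_comp.
  by apply: ge0_integral_same_law => //; exact: measurable_funeneg.
Qed.

End SameLaw.

Section KernelIntegral.
Context d1 d2 (T1 : measurableType d1) (T2 : measurableType d2) (R : realType).
Variables (k : T1 -> {measure set T2 -> \bar R}).
Hypothesis mk : forall A, measurable A -> measurable_fun setT (k ^~ A).

Lemma measurable_Rintegral_kernel (h : T2 -> R) : measurable_fun setT h ->
  measurable_fun setT (fun x => (\int[k x]_w h w)%R).
Proof.
move=> mh; rewrite /Rintegral; apply: (@measurableT_comp _ _ _ _ _ _ fine).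
  exact: fine_measurable.
have mh' : measurable_fun setT (EFin \o h) by exact/measurable_EFinP.
under eq_fun do rewrite integralE.
apply: emeasurable_funB; apply: measurable_fun_integral_kernel => //.
  exact: measurable_funepos.
exact: measurable_funeneg.
Qed.

End KernelIntegral.

Section Law.
Context d1 d2 (T1 : measurableType d1) (T2 : measurableType d2) (R : realType).
Variables (m : {measure set T1 -> \bar R}) (phi : T1 -> T2).
Hypothesis mphi : measurable_fun setT phi.

(** The image measure, bundled with the proof that the map is measurable. *)
Definition law : {measure set T2 -> \bar R} :=
  measure_function_pushforward__canonical__measure_function_Measure m mphi.

Lemma Rintegral_law (h : T2 -> R) : measurable_fun setT h ->
  (\int[law]_y h y = \int[m]_w h (phi w))%R.
Proof.
move=> mh; rewrite /Rintegral; congr fine.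
apply: (integral_same_law (phi1 := id) (phi2 := phi) _ _ _ (h := EFin \o h)) => //.
exact/measurable_EFinP.
Qed.

End Law.

Section Process.
Context dS (S : measurableType dS) dO (Omega : measurableType dO) (R : realType).
Variables (X : R -> Omega -> S) (P : R.-pker S ~> Omega) (mu : probability S R).
Hypotheses (markovX : markov_process X P) (invmu : invariant_law X P mu).

Local Notation Pmu := (started_from mu P).

(** Extended to negative times so as to be jointly measurable on the whole line,
    which spares side conditions on the sign of times. *)
Definition state (s : R) (w : Omega) : S := X (Num.max 0%R s) w.

Lemma stateE s : (0 <= s)%R -> state s = X s.
Proof. by move=> s0; rewrite /state max_r. Qed.

Lemma measurable_state2 :
  measurable_fun setT (fun sw : R * Omega => state sw.1 sw.2).
Proof.
rewrite (_ : (fun sw => _) = (fun tw => X tw.1 tw.2) \o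
    (fun sw : R * Omega => (Num.max 0%R sw.1, sw.2)))//.
apply: (@measurable_comp _ _ _ _ _ _ ([set t : R | (0 <= t)%R] `*` [set: Omega])).
- apply: measurableX => //.
  rewrite (_ : [set t | _] = `[0%R, +oo[%classic); first exact: measurable_itv.
  by apply/seteqP; split => t /=; rewrite in_itv/= andbT.
- by move=> _ [sw _ <-] /=; split => //=; rewrite le_max lexx.
- exact: (markov_measurable markovX).
- apply: measurable_fun_pair => //.
  exact: measurable_maxr.
Qed.

Lemma measurable_state s : measurable_fun setT (state s).
Proof. exact: (measurable_fun_pair2 s measurable_state2). Qed.

Lemma state_law s A : measurable A -> Pmu (state s @^-1` A) = mu A.
Proof. by move=> mA; rewrite /state invmu// le_max lexx. Qed.

Lemma Rintegral_state s (h : S -> R) : measurable_fun setT h ->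
  (\int[Pmu]_w h (state s w) = \int[mu]_x h x)%R.
Proof.
move=> mh; rewrite /Rintegral; congr fine.
apply: (integral_same_law (phi1 := state s) (phi2 := id) _ _ _ (h := EFin \o h)).
- exact: measurable_state.
- exact: measurable_id.
- by move=> A mA; exact: state_law.
- exact/measurable_EFinP.
Qed.

Lemma ge0_integral_state s (h : S -> \bar R) : measurable_fun setT h ->
  (forall y, 0 <= h y) -> \int[Pmu]_w h (state s w) = \int[mu]_x h x.
Proof.
move=> mh h0; apply: (ge0_integral_same_law (phi1 := state s) (phi2 := id)) => //.
  exact: measurable_state.
by move=> A mA; exact: state_law.
Qed.

Lemma ge0_integral_started_from (h : Omega -> \bar R) :
  measurable_fun setT h -> (forall w, 0 <= h w) ->
  \int[Pmu]_w h w = \int[mu]_x \int[P x]_w h w.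
Proof.
by move=> mh h0; apply: ge0_integral_mixture => // A mA; exact: measurable_kernel.
Qed.

Lemma Rintegral_started_from (h : Omega -> R) :
  Pmu.-integrable setT (EFin \o h) ->
  mu.-integrable setT (fun x => (\int[P x]_w h w)%R%:E) /\
  (\int[Pmu]_w h w = \int[mu]_x (\int[P x]_w h w))%R.
Proof.
by move=> ih; apply: Rintegral_mixture => // A mA; exact: measurable_kernel.
Qed.

Lemma markov_state s t x A B : (0 <= s)%R -> (0 <= t)%R -> measurable A -> measurable B ->
  P x (state s @^-1` B `&` state (s + t)%R @^-1` A) =
  \int[P x]_(w in state s @^-1` B) P (state s w) (state t @^-1` A).
Proof.
move=> s0 t0 mA mB; rewrite !stateE ?addr_ge0//.
apply: (markov_property markovX) => //.
apply: sub_sigma_algebra; exists s; first by rewrite /= in_itv/= s0 lexx.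
by exists B => //; rewrite setTI.
Qed.

(** The Markov property only speaks of events; it says that the law of the state
    at time [r + s] is the mixture of the laws at time [s] of the processes restarted
    from the state at time [r]. *)
Lemma Rintegral_markov r s x (h : S -> R) : (0 <= r)%R -> (0 <= s)%R ->
  measurable_fun setT h -> (P x).-integrable setT (fun w => (h (state (r + s) w))%:E) ->
  (\int[P x]_w h (state (r + s) w) =
   \int[P x]_w (\int[P (state r w)]_w' h (state s w')))%R.
Proof.
move=> r0 s0 mh ih.
rewrite -(Rintegral_law (P x) (measurable_state (r + s)) mh).
under [RHS]eq_Rintegral do rewrite -(Rintegral_law _ (measurable_state s) mh).
apply: (Rintegral_mixture (k := fun w => law (P (state r w)) (measurable_state s)) _ _ _).2.
- move=> A mA; apply: (measurableT_comp (measurable_kernel P _ _)) => //.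
    by rewrite -[_ @^-1` _]setTI; exact: measurable_state.
  exact: measurable_state.
- move=> A mA; have := markov_state x r0 s0 mA measurableT.
  by rewrite preimage_setT setTI.
- apply: integrable_pushforward => //; first exact: measurable_state.
  exact/measurable_EFinP.
Qed.

(** By invariance the state at time [s] has law [mu], so the right-hand side does
    not depend on [s]. *)
Lemma state_pair s t A B : (0 <= s)%R -> (0 <= t)%R -> measurable A -> measurable B ->
  Pmu (state s @^-1` A `&` state (s + t)%R @^-1` B) =
  \int[mu]_(y in A) P y (state t @^-1` B).
Proof.
move=> s0 t0 mA mB; pose k y := P y (state t @^-1` B).
have mk : measurable_fun setT k.
  apply: measurable_kernel; rewrite -[_ @^-1` _]setTI; exact: measurable_state.
have mkA : measurable_fun setT (k \_ A).
  by apply/(measurable_restrictT _ mA)/measurable_funTS.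
have kA0 y : 0 <= (k \_ A) y by rewrite /patch; case: ifPn.
rewrite [RHS]integral_mkcond -/k -(ge0_integral_state s mkA kA0).
rewrite ge0_integral_started_from//; last first.
  exact: (measurableT_comp mkA (measurable_state s)).
apply: eq_integral => x _; rewrite markov_state// integral_mkcond.
by apply: eq_integral => w _; rewrite /patch.
Qed.

(** Both pairs of times give the same law on [S * S], because rectangles generate
    the product sigma-algebra. *)
Lemma Rintegral_pair s t (h : S * S -> R) : (0 <= s)%R -> (0 <= t)%R ->
  measurable_fun setT h ->
  (\int[Pmu]_w h (state s w, state (s + t) w) =
   \int[Pmu]_w h (state 0 w, state t w))%R.
Proof.
move=> s0 t0 mh.
have mp u v : measurable_fun setT (fun w => (state u w, state v w)).
  by apply: measurable_fun_pair; exact: measurable_state.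
rewrite -(Rintegral_law Pmu (mp s (s + t)%R) mh) -(Rintegral_law Pmu (mp 0%R t) mh).
rewrite /Rintegral; congr fine; apply: eq_measure_integral => C mC _.
apply: (measure_unique [set A `*` B | A in measurable & B in measurable] (fun=> setT)) => //.
- exact: measurable_prod_measurableType.
- move=> _ _ [A mA [B mB <-]] [A' mA' [B' mB' <-]].
  exists (A `&` A'); first exact: measurableI.
  by exists (B `&` B'); [exact: measurableI|rewrite setXI].
- by move=> _; exists setT => //; exists setT => //; rewrite setXTT.
- by apply/seteqP; split => // x _; exists 0%N.
- move=> _ [A mA [B mB <-]].
  have E u v : law Pmu (mp u v) (A `*` B) =
    Pmu (state u @^-1` A `&` state v @^-1` B) by [].
  rewrite !E state_pair//; have := state_pair (lexx 0%R) t0 mA mB.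
  by rewrite add0r => ->.
- by move=> _; rewrite -[X in X < _]/(Pmu setT) probability_setT ltry.
Qed.

End Process.

(** * Evaluation, conditioning and path integration as operators *)

Section RdotSplit.
Context d (T : measurableType d) (R : realType) (m : {measure set T -> \bar R}).

Lemma integral_rdot (D : set T) (f : T -> R[i]) : measurable D -> cmeasurable f ->
  \int[m]_(x in D) (rdot (f x) (f x))%:E =
  \int[m]_(x in D) ((complex.Re (f x)) ^+ 2)%:E +
  \int[m]_(x in D) ((complex.Im (f x)) ^+ 2)%:E.
Proof.
move=> mD [fr fi].
rewrite -ge0_integralD//.
- by move=> x _; rewrite lee_fin sqr_ge0.
- by apply/measurable_EFinP/measurable_funX; exact: measurable_funTS.
- by move=> x _; rewrite lee_fin sqr_ge0.
- by apply/measurable_EFinP/measurable_funX; exact: measurable_funTS.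
Qed.

Lemma rdot_cintegral_le (D : set T) (c : R) (f : T -> R[i]) :
  measurable D -> m D = c%:E -> cmeasurable f ->
  (rdot (cintegral m D f) (cintegral m D f))%:E <=
  c%:E * \int[m]_(x in D) (rdot (f x) (f x))%:E.
Proof.
move=> mD mDc mf; rewrite integral_rdot//; have [fr fi] := mf.
rewrite ge0_muleDr; last 2 first.
- by apply: integral_ge0 => x _; rewrite lee_fin sqr_ge0.
- by apply: integral_ge0 => x _; rewrite lee_fin sqr_ge0.
rewrite /rdot /= -!expr2 EFinD; apply: leeD.
  by apply: sqr_Rintegral_le => //; exact: measurable_funTS.
by apply: sqr_Rintegral_le => //; exact: measurable_funTS.
Qed.

Lemma cmeasurable_comp d' (T' : measurableType d') (phi : T' -> T) (f : T -> R[i]) :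
  measurable_fun setT phi -> cmeasurable f -> cmeasurable (f \o phi).
Proof.
by move=> mphi [fr fi]; split; [exact: (measurableT_comp fr)|exact: (measurableT_comp fi)].
Qed.

Lemma measurable_rdot_EFin (f g : T -> R[i]) : cmeasurable f -> cmeasurable g ->
  measurable_fun setT (fun x => (rdot (f x) (g x))%:E).
Proof. by move=> mf mg; apply/measurable_EFinP; exact: measurable_rdot. Qed.

Lemma l2cm (f : l2 m) : cmeasurable (l2fun f).
Proof. by have [] := l2P f. Qed.

Lemma snorm_le (f : l2 m) (c : R) : (0 <= c)%R ->
  \int[m]_x (rdot (l2fun f x) (l2fun f x))%:E <= (c ^+ 2)%:E ->
  (snorm (@dot _ _ _ m) f <= c)%R.
Proof.
move=> c0; have := integrable_fin_num measurableT (L2_integrable (l2P f)).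
move=> /fineK <-; rewrite lee_fin => h.
by rewrite -ler_sqr ?nnegrE ?snorm_ge0// (sqr_snorm (@dot_semi_inner _ _ _ m)).
Qed.

End RdotSplit.

Section Operators.
Context dS (S : measurableType dS) dO (Omega : measurableType dO) (R : realType).
Variables (X : R -> Omega -> S) (P : R.-pker S ~> Omega) (mu : probability S R).
Hypotheses (markovX : markov_process X P) (invmu : invariant_law X P mu).

Local Notation Pmu := (started_from mu P).
Local Notation Y := (state X).
Local Notation dmu := (@dot _ _ R mu).
Local Notation dP := (@dot _ _ R Pmu).

Let mY s : measurable_fun setT (Y s) := measurable_state markovX s.

Lemma at_time_subproof s (g : l2 mu) : L2 Pmu (l2fun g \o Y s).
Proof.
apply/L2P; split; first exact: (cmeasurable_comp (mY s) (l2cm g)).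
rewrite (ge0_integral_state markovX invmu s (h := fun x => (rdot (l2fun g x) (l2fun g x))%:E)).
- by have /L2P[] := l2P g.
- by apply: measurable_rdot_EFin; exact: l2cm.
- by move=> x; rewrite lee_fin rdot_ge0.
Qed.

Definition at_time s (g : l2 mu) : l2 Pmu := MkL2 (mem_set (at_time_subproof s g)).

Lemma at_timeD s x y : (at_time s (x + y) = at_time s x + at_time s y)%R.
Proof. exact: val_inj. Qed.

Lemma at_timeZ s (a : R) x : (at_time s (a *: x) = a *: at_time s x)%R.
Proof. exact: val_inj. Qed.

Lemma dot_at_time s x y : dP (at_time s x) (at_time s y) = dmu x y.
Proof.
apply: (Rintegral_state markovX invmu s (h := fun u => rdot (l2fun x u) (l2fun y u))).
by apply: measurable_rdot; exact: l2cm.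
Qed.

Lemma dot_stationary s t x y : (0 <= s)%R -> (0 <= t)%R ->
  dP (at_time s x) (at_time (s + t) y) = dP (at_time 0 x) (at_time t y).
Proof.
move=> s0 t0.
apply: (Rintegral_pair markovX invmu (h := fun u => rdot (l2fun x u.1) (l2fun y u.2))) => //.
apply: (measurable_rdot (f := l2fun x \o fst) (g := l2fun y \o snd)).
  exact: (cmeasurable_comp measurable_fst (l2cm x)).
exact: (cmeasurable_comp measurable_snd (l2cm y)).
Qed.

Lemma rdot_cintegral_kernel (z : l2 Pmu) x :
  (rdot (cintegral (P x) setT (l2fun z)) (cintegral (P x) setT (l2fun z)))%:E <=
  \int[P x]_w (rdot (l2fun z w) (l2fun z w))%:E.
Proof.
rewrite -[leRHS]mul1e; apply: rdot_cintegral_le => //; last exact: l2cm.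
exact: prob_kernel.
Qed.

Lemma cond_exp_subproof (z : l2 Pmu) : L2 mu (fun x => cintegral (P x) setT (l2fun z)).
Proof.
have mk A : measurable A -> measurable_fun setT (fun x => P x A) by exact: measurable_kernel.
have mz := l2cm z.
have mU : cmeasurable (fun x => cintegral (P x) setT (l2fun z)).
  by split; apply: measurable_Rintegral_kernel => //; [exact: mz.1|exact: mz.2].
apply/L2P; split => //.
have /L2P[_] := l2P z; apply: le_lt_trans.
rewrite ge0_integral_started_from; last 2 first.
- exact: measurable_rdot_EFin.
- by move=> w; rewrite lee_fin rdot_ge0.
apply: ge0_le_integral => //.
- by move=> x _; rewrite lee_fin rdot_ge0.
- exact: measurable_rdot_EFin.
- apply: measurable_fun_integral_kernel => //.
    by move=> w; rewrite lee_fin rdot_ge0.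
  exact: measurable_rdot_EFin.
- by move=> x _; exact: rdot_cintegral_kernel.
Qed.

Definition cond_exp (z : l2 Pmu) : l2 mu := MkL2 (mem_set (cond_exp_subproof z)).

Lemma ae_integrable_kernel (z : l2 Pmu) : {ae mu, forall x,
  (P x).-integrable setT (fun w => (complex.Re (l2fun z w))%:E) /\
  (P x).-integrable setT (fun w => (complex.Im (l2fun z w))%:E)}.
Proof.
have mz := l2cm z.
have iz : mu.-integrable setT (fun x => \int[P x]_w (rdot (l2fun z w) (l2fun z w))%:E).
  apply/integrableP; split.
    apply: measurable_fun_integral_kernel => //.
    - by move=> A; exact: measurable_kernel.
    - by move=> w; rewrite lee_fin rdot_ge0.
    - exact: measurable_rdot_EFin.
  rewrite (eq_integral (fun x => \int[P x]_w (rdot (l2fun z w) (l2fun z w))%:E)).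
    rewrite -ge0_integral_started_from; last 2 first.
    - exact: measurable_rdot_EFin.
    - by move=> w; rewrite lee_fin rdot_ge0.
    by have /L2P[] := l2P z.
  by move=> x _; rewrite gee0_abs// integral_ge0// => w _; rewrite lee_fin rdot_ge0.
have := integrable_ae measurableT iz; apply: filterS => x /(_ I) fx.
have P1 : P x setT = 1%:E by exact: prob_kernel.
move: fx; rewrite integral_rdot// fin_numD => /andP[fr fi]; split.
  by apply: (sqr_integrable measurableT P1 mz.1); rewrite ltey_eq fr.
by apply: (sqr_integrable measurableT P1 mz.2); rewrite ltey_eq fi.
Qed.

(** Points of [S] need not be measurable, but the level set of [h] through [x] is,
    and it carries the whole law of the initial state of the process started at
    [x]. *)
Lemma initial_ae (h : S -> R[i]) x : cmeasurable h ->
  {ae P x, forall w, h (Y 0 w) = h x}.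
Proof.
move=> [hr hi].
pose A := [set y | h y = h x].
have mA : measurable A.
  rewrite (_ : A = (fun y => complex.Re (h y)) @^-1` [set complex.Re (h x)] `&`
     (fun y => complex.Im (h y)) @^-1` [set complex.Im (h x)]).
    by apply: measurableI; rewrite -[X in measurable X]setTI; [exact: hr|exact: hi].
  apply/seteqP; split => y; rewrite /A/=; first by move=> ->.
  by case: (h y) (h x) => [? ?] [? ?] /= [-> ->].
exists (Y 0 @^-1` ~` A); split => //.
  by rewrite -[X in measurable X]setTI; apply: mY => //; exact: measurableC.
rewrite (stateE _ (lexx 0%R)) (markov_initial markovX); last exact: measurableC.
by rewrite diracE memNset// => /(_ erefl).
Qed.

(** Under [P x] the factor [h (X 0)] is the constant [h x] and leaves the inner
    integral. *)
Lemma dot_cond_exp h z : dmu h (cond_exp z) = dP (at_time 0 h) z.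
Proof.
rewrite /dot.
have := Rintegral_started_from (L2_integrable_rdot (l2P (at_time 0 h)) (l2P z)).
move=> [ih ->]; rewrite /Rintegral; congr fine; apply: ae_eq_integral => //.
- by apply: measurable_rdot_EFin; exact: l2cm.
- exact: (measurable_int _ ih).
have := ae_integrable_kernel z; apply: filterS => x [ir ii] _.
rewrite -/(Rintegral _ _ _); congr EFin.
transitivity (\int[P x]_w rdot (l2fun h x) (l2fun z w))%R.
  rewrite /rdot RintegralD//; last 2 first.
  - exact: (integrableZl measurableT (complex.Re (l2fun h x)) ir).
  - exact: (integrableZl measurableT (complex.Im (l2fun h x)) ii).
  by rewrite !RintegralZl.
rewrite /Rintegral; congr fine; apply: ae_eq_integral => //.
- apply: measurable_rdot_EFin; last exact: l2cm.
  by split; exact: measurable_cst.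
- by apply: measurable_rdot_EFin; exact: l2cm.
by apply: filterS (initial_ae x (l2cm h)) => w /= -> _.
Qed.

Lemma semigroup_cond_exp t (g : l2 mu) : (0 <= t)%R ->
  semigroup X P t (l2fun g) = l2fun (cond_exp (at_time t g)).
Proof. by move=> t0; rewrite /semigroup/= stateE. Qed.

Lemma chapman_kolmogorov r s g : (0 <= r)%R -> (0 <= s)%R ->
  weq dmu (cond_exp (at_time r (cond_exp (at_time s g)))) (cond_exp (at_time (r + s) g)).
Proof.
move=> r0 s0; apply: snorm_ae.
have := ae_integrable_kernel (at_time (r + s) g); apply: filterS => x [ir ii].
rewrite /= /cintegral/=; congr Complex.
  exact/esym/(Rintegral_markov markovX r0 s0 (l2cm g).1 ir).
exact/esym/(Rintegral_markov markovX r0 s0 (l2cm g).2 ii).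
Qed.

End Operators.

Section ComplexPathIntegral.
Context dO (Omega : measurableType dO) (R : realType).
Variable m : {sigma_finite_measure set Omega -> \bar R}.
Variables (a b M : R) (G : R * Omega -> R[i]).
Local Notation leb := (@lebesgue_measure R).
Hypothesis mG : cmeasurable G.

Lemma cmeasurable_path_integral :
  cmeasurable (fun w => cintegral leb `[a, b] (fun s => G (s, w))).
Proof.
by split; [exact: (measurable_path_integral a b mG.1)|exact: (measurable_path_integral a b mG.2)].
Qed.

Hypothesis ab : (a <= b)%R.
Hypothesis GM : forall s, (a <= s <= b)%R ->
  \int[m]_w (rdot (G (s, w)) (G (s, w)))%:E <= (M ^+ 2)%:E.

Let VR sw := complex.Re (G sw).
Let VI sw := complex.Im (G sw).

Let msqr (V : R * Omega -> R) : measurable_fun setT V ->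
  measurable_fun `[a, b]%classic (fun s => \int[m]_w ((V (s, w)) ^+ 2)%:E).
Proof.
move=> mV; have mV2 : measurable_fun setT (fun sw => ((V sw) ^+ 2)%:E).
  by apply/measurable_EFinP; exact: measurable_funX.
have V20 sw : 0 <= ((V sw) ^+ 2)%:E by rewrite lee_fin sqr_ge0.
exact: measurable_funTS (measurable_fun_fubini_tonelli_F (m2 := m) _ mV2 V20).
Qed.

Let inner_ge0 (V : R * Omega -> R) s : 0 <= \int[m]_w ((V (s, w)) ^+ 2)%:E.
Proof. by apply: integral_ge0 => w _; rewrite lee_fin sqr_ge0. Qed.

Let double_le :
  \int[leb]_(s in `[a, b]) \int[m]_w ((VR (s, w)) ^+ 2)%:E +
  \int[leb]_(s in `[a, b]) \int[m]_w ((VI (s, w)) ^+ 2)%:E <= ((b - a) * M ^+ 2)%:E.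
Proof.
rewrite -ge0_integralD//; last 2 first.
- exact: msqr mG.1.
- exact: msqr mG.2.
apply: (@le_trans _ _ (\int[leb]_(s in `[a, b]) (M ^+ 2)%:E)).
  apply: ge0_le_integral => //.
  - by move=> s _; rewrite adde_ge0.
  - by apply: emeasurable_funD; [exact: msqr mG.1|exact: msqr mG.2].
  - move=> s /=; rewrite in_itv/= => /GM; rewrite integral_rdot//.
    split; [exact: (measurableT_comp mG.1 (pair1_measurable s))|].
    exact: (measurableT_comp mG.2 (pair1_measurable s)).
rewrite integral_cst//= lebesgue_measure_itv/= lte_fin.
rewrite lt_neqAle ab andbT; case: eqVneq => [->|_] /=.
  by rewrite mule0 subrr mul0r.
by rewrite -EFinD -EFinM mulrC.
Qed.

Lemma rdot_path_integral_le :
  \int[m]_w (rdot (cintegral leb `[a, b] (fun s => G (s, w)))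
    (cintegral leb `[a, b] (fun s => G (s, w))))%:E <= (((b - a) * M) ^+ 2)%:E.
Proof.
rewrite integral_rdot//; last exact: cmeasurable_path_integral.
apply: le_trans (leeD (sqr_path_integral_le m mG.1 ab) (sqr_path_integral_le m mG.2 ab)) _.
rewrite -ge0_muleDr; last 2 first.
- by apply: integral_ge0 => s _; exact: (inner_ge0 VR s).
- by apply: integral_ge0 => s _; exact: (inner_ge0 VI s).
rewrite exprMn expr2 -mulrA EFinM; apply: (lee_wpmul2l _ double_le).
by rewrite lee_fin subr_ge0.
Qed.

Lemma cpath_integrable_ae : {ae m, forall w,
  leb.-integrable `[a, b] (fun s => (complex.Re (G (s, w)))%:E) /\
  leb.-integrable `[a, b] (fun s => (complex.Im (G (s, w)))%:E)}.
Proof.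
have dlt := le_lt_trans double_le (ltry _).
have pos V : 0 <= \int[leb]_(s in `[a, b]) \int[m]_w ((V (s, w)) ^+ 2)%:E.
  by apply: integral_ge0 => s _; exact: (inner_ge0 V s).
have aeR := path_integrable_ae mG.1 ab (le_lt_trans (leeDl _ (pos VI)) dlt).
have aeI := path_integrable_ae mG.2 ab (le_lt_trans (leeDr _ (pos VR)) dlt).
by apply: filterS2 aeR aeI => w.
Qed.

End ComplexPathIntegral.

Section PathOperator.
Context dS (S : measurableType dS) dO (Omega : measurableType dO) (R : realType).
Variables (X : R -> Omega -> S) (P : R.-pker S ~> Omega) (mu : probability S R).
Hypotheses (markovX : markov_process X P) (invmu : invariant_law X P mu).

Local Notation Pmu := (started_from mu P).
Local Notation Y := (state X).
Local Notation leb := (@lebesgue_measure R).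
Local Notation dmu := (@dot _ _ R mu).
Local Notation dP := (@dot _ _ R Pmu).
Local Notation I_ := (at_time markovX invmu).

Let mG (g : l2 mu) : cmeasurable (fun sw : R * Omega => l2fun g (Y sw.1 sw.2)).
Proof. exact: (cmeasurable_comp (measurable_state2 markovX) (l2cm g)). Qed.

Let sqr_at_time s (f : l2 mu) :
  \int[Pmu]_w (rdot (l2fun f (Y s w)) (l2fun f (Y s w)))%:E = (snorm dmu f ^+ 2)%:E.
Proof.
rewrite (ge0_integral_state markovX invmu s (h := fun x => (rdot (l2fun f x) (l2fun f x))%:E)).
- rewrite (sqr_snorm (@dot_semi_inner _ _ _ _)).
  by have := integrable_fin_num measurableT (L2_integrable (l2P f)) => /fineK.
- by apply: measurable_rdot_EFin; exact: l2cm.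
- by move=> x; rewrite lee_fin rdot_ge0.
Qed.

Lemma path_integral_subproof a b (g : l2 mu) :
  L2 Pmu (fun w => cintegral leb `[a, b] (fun s => l2fun g (Y s w))).
Proof.
apply/L2P; split; first exact: (cmeasurable_path_integral a b (mG g)).
have [ab|ba] := leP a b.
  have := rdot_path_integral_le (m := Pmu) (mG g) ab (M := snorm dmu g).
  move=> /(_ _)/le_lt_trans; apply; last exact: ltry.
  by move=> s _; rewrite sqr_at_time.
rewrite integral0_eq ?ltry// => w _.
by rewrite /cintegral set_itv_ge ?bnd_simp -?ltNge// !Rintegral_set0 /rdot/= mulr0 addr0.
Qed.

Definition path_integral a b (g : l2 mu) : l2 Pmu :=
  MkL2 (mem_set (path_integral_subproof a b g)).

Let ae_int a b (g : l2 mu) : (a <= b)%R -> {ae Pmu, forall w,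
  leb.-integrable `[a, b] (fun s => (complex.Re (l2fun g (Y s w)))%:E) /\
  leb.-integrable `[a, b] (fun s => (complex.Im (l2fun g (Y s w)))%:E)}.
Proof.
move=> ab; apply: (cpath_integrable_ae (m := Pmu) (mG g) ab (M := snorm dmu g)) => s _.
by rewrite sqr_at_time.
Qed.

Lemma path_integral_add a b c (g : l2 mu) : (a <= b)%R -> (b <= c)%R ->
  weq dP (path_integral a b g + path_integral b c g)%R (path_integral a c g).
Proof.
move=> ab bc; apply: snorm_ae; have := ae_int g (le_trans ab bc).
apply: filterS => w [ir ii]; rewrite /= /cintegral.
have E (f : R -> R) : leb.-integrable `[a, c] (EFin \o f) ->
   (\int[leb]_(s in `[a, c]) f s =
    \int[leb]_(s in `[a, b]) f s + \int[leb]_(s in `[b, c]) f s)%R.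
  move=> fi; have := Rintegral_itvB fi (x := b).
  rewrite !bnd_simp => /(_ ab bc) /(canRL (subrK _)) ->; rewrite addrC; congr (_ + _)%R.
  rewrite Rintegral_itv_obnd_cbnd//; apply: integrableS fi => //.
  by apply: subset_itv; rewrite bnd_simp.
by rewrite -[RHS]/(Complex _ _) (E _ ir) (E _ ii).
Qed.

(** Jensen's inequality in time, applied to [g (X s) - g (X a)]. *)
Lemma path_integral_loc a b (g : l2 mu) (M : R) : (a <= b)%R -> (0 <= M)%R ->
  (forall s, (a <= s <= b)%R -> (snorm dP (I_ s g - I_ a g) <= M)%R) ->
  (snorm dP (path_integral a b g - (b - a) *: I_ a g) <= (b - a) * M)%R.
Proof.
move=> ab M0 H.
pose G (sw : R * Omega) : Rcomplex R := (l2fun g (Y sw.1 sw.2) - l2fun g (Y a sw.2))%R.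
have mGa : cmeasurable G.
  apply: (cmeasurableD (mG g) (g := fun sw => (- l2fun g (Y a sw.2))%R)).
  rewrite (_ : (fun sw => _) = fun sw : R * Omega => (-1 *: l2fun g (Y a sw.2))%R).
    apply: cmeasurableZ; apply: (@cmeasurable_comp _ _ _ _ _ (Y a \o snd) (l2fun g)).
      exact: (measurableT_comp (measurable_state markovX a) measurable_snd).
    exact: l2cm.
  by apply/funext => sw; rewrite scaleN1r.
have GM s : (a <= s <= b)%R ->
    \int[Pmu]_w (rdot (G (s, w)) (G (s, w)))%:E <= (M ^+ 2)%:E.
  move=> /H sM.
  have := integrable_fin_num measurableT (L2_integrable (l2P (I_ s g - I_ a g)%R)).
  move=> /fineK; rewrite -[fine _]/(dP _ _) -(sqr_snorm (@dot_semi_inner _ _ _ _)) => <-.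
  by rewrite lee_fin ler_sqr ?nnegrE ?snorm_ge0.
apply: snorm_le; first by rewrite mulr_ge0 ?subr_ge0.
apply: le_trans (rdot_path_integral_le (m := Pmu) mGa ab GM).
rewrite le_eqVlt; apply/orP; left; apply/eqP; apply: ae_eq_integral => //.
- by apply: measurable_rdot_EFin; exact: l2cm.
- have := cmeasurable_path_integral a b mGa.
  by move=> h; exact: (measurable_rdot_EFin h h).
have := ae_int g ab; apply: filterS => w [ir ii] _; congr EFin.
have lab : leb `[a, b]%classic = (b - a)%:E.
  rewrite lebesgue_measure_itv/= lte_fin lt_neqAle ab andbT.
  by case: eqVneq => [->|_] //=; rewrite subrr.
have E (f : R -> R) c : leb.-integrable `[a, b] (EFin \o f) ->
   (\int[leb]_(s in `[a, b]) (f s - c) = \int[leb]_(s in `[a, b]) f s - (b - a) * c)%R.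
  move=> fi; rewrite RintegralB//; last first.
    apply/integrableP; split; first exact: (measurable_cst c%:E).
    by rewrite (eq_integral (cst `|c|%:E))// integral_cst//= lab -EFinM ltry.
  rewrite Rintegral_cst// [(c * _)%R]mulrC; congr (_ - _ * _)%R.
  exact: (congr1 fine lab).
suff -> : l2fun (path_integral a b g - (b - a) *: I_ a g)%R w =
  cintegral leb `[a, b] (fun s => G (s, w)) by [].
rewrite -[LHS]/(cintegral leb `[a, b] (fun s => l2fun g (Y s w)) - (b - a) *: l2fun g (Y a w) : Rcomplex R)%R.
have R_sub (y z : Rcomplex R) : complex.Re (y - z)%R = (complex.Re y - complex.Re z)%R.
  by case: y z => [? ?] [? ?].
have I_sub (y z : Rcomplex R) : complex.Im (y - z)%R = (complex.Im y - complex.Im z)%R.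
  by case: y z => [? ?] [? ?].
have ext (y z : R[i]) : complex.Re y = complex.Re z -> complex.Im y = complex.Im z -> y = z.
  by case: y z => [? ?] [? ?] /= -> ->.
have R_scale (r : R) (y : Rcomplex R) : complex.Re (r *: y)%R = (r * complex.Re y)%R by case: y.
have I_scale (r : R) (y : Rcomplex R) : complex.Im (r *: y)%R = (r * complex.Im y)%R by case: y.
apply: ext.
- rewrite R_sub R_scale; apply/esym; apply: etrans (E _ _ ir).
  by apply: eq_Rintegral => s _; rewrite /G R_sub.
- rewrite I_sub I_scale; apply/esym; apply: etrans (E _ _ ii).
  by apply: eq_Rintegral => s _; rewrite /G I_sub.
Qed.

End PathOperator.

(** * The asymptotic variance *)

Section Asymptotics.
Context dS (S : measurableType dS) dO (Omega : measurableType dO) (R : realType).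

Lemma cvg0_rightP (u : R -> R) (f : R -> \bar R) :
  (forall t, (0 < t)%R -> f t = (u t)%:E) ->
  (f t @[t --> 0%R^'+] --> 0%:E <-> forall e : R, (0 < e)%R ->
    exists2 d : R, (0 < d)%R & forall t, (0 < t < d)%R -> (`|u t| <= e)%R).
Proof.
move=> fu; split.
  move=> /fine_cvgP[_ /cvgr0Pnorm_le H] e e0.
  have [d /= d0 {}H] := H e e0; exists d => // t /andP[t0 td].
  have := H t _ t0; rewrite /= fu//=; apply.
  by rewrite sub0r normrN gtr0_norm.
move=> H; apply: cvg_EFin.
  by near=> t; rewrite fu.
apply/cvgr0Pnorm_le => e e0; have [d d0 {}H] := H e e0.
near=> t; rewrite /= fu//=; apply: H; apply/andP; split => //.
Unshelve. all: by end_near. Qed.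

Lemma scale_complexE (a : R) (z : R[i]) :
  (a%:C%C * z)%R = (a *: (z : Rcomplex R))%R :> R[i].
Proof. by case: z => b c /=; congr Complex; rewrite /= mul0r ?subr0 ?addr0. Qed.

(** A function whose oscillation between [s] and [t] is at most [c / t + c / s]
    converges; the infimum below squeezes its limit. *)
Lemma cvg_harmonic_osc (v : R -> R) (c : R) :
  (forall s t, (0 < s)%R -> (0 < t)%R -> (`|v t - v s| <= c * (t^-1 + s^-1))%R) ->
  exists2 l, v t @[t --> +oo%R] --> l &
    forall t, (0 < t)%R -> (`|v t - l| <= c * t^-1)%R.
Proof.
move=> H.
pose E := [set v t + c * t^-1 | t in [set t : R | 0 < t]]%R.
have lbE s : (0 < s)%R -> lbound E (v s - c * s^-1)%R.
  by move=> s0 _ [t t0 <-]; have /ler_normlP[] := H s t s0 t0; lra.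
have infE : has_inf E.
  split; first by exists (v 1 + c * 1^-1)%R; exists 1%R => //=.
  by exists (v 1 - c * 1^-1)%R; exact: lbE.
have vl t : (0 < t)%R -> (`|v t - inf E| <= c * t^-1)%R.
  move=> t0; have h1 : (inf E <= v t + c * t^-1)%R.
    by apply: ge_inf; [exact: infE.2|exists t].
  have h2 : (v t - c * t^-1 <= inf E)%R.
    by apply: lb_le_inf; [exact: infE.1|exact: lbE].
  by apply/ler_normlP; split; lra.
exists (inf E) => //.
apply/cvgrPdist_le => e e0.
near=> t.
have t0 : (0 < t)%R by [].
rewrite distrC; apply: (le_trans (vl t t0)).
rewrite ler_pdivrMr// mulrC -ler_pdivrMr//.
Unshelve. all: by end_near. Qed.

Variables (X : R -> Omega -> S) (P : R.-pker S ~> Omega) (mu : probability S R).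
Variable K : set (S -> R[i]).
Hypotheses (markovX : markov_process X P) (invmu : invariant_law X P mu).
Hypotheses (contP : strongly_continuous X P mu) (subK : closed_subspace mu K).
Hypotheses (K0 : K `<=` L20 mu).
Hypothesis stableK : forall (t : R) g, (0 <= t)%R -> K g -> K (semigroup X P t g).

Local Notation dmu := (@dot _ _ R mu).
Local Notation Pmu := (started_from mu P).
Local Notation dP := (@dot _ _ R Pmu).
Local Notation I_ := (at_time markovX invmu).
Local Notation Z := (path_integral markovX invmu).
Local Notation Pt t g := (cond_exp (I_ t g)).

Let KH (g : l2 mu) := K (l2fun g).

Let P_cont (g : l2 mu) (e : R) : (0 < e)%R ->
  exists2 r0 : R, (0 < r0)%R & forall r, (0 < r < r0)%R -> (snorm dmu (Pt r g - g) <= e)%R.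
Proof.
move=> e0; have := contP (l2P g).
have E t : (0 < t)%R -> normL2 mu (fun x => semigroup X P t (l2fun g) x - l2fun g x)%R
    = (snorm dmu (Pt t g - g)%R)%:E.
  by move=> t0; rewrite -normL2_snorm (semigroup_cond_exp markovX invmu)// ltW.
move=> /(cvg0_rightP E)/(_ e e0)[d d0 H]; exists d => // t /H.
by rewrite ger0_norm// snorm_ge0.
Qed.

Let generator_agen (f h : l2 mu) : agen dmu I_ (@cond_exp _ _ _ _ _ P mu) f h ->
  generator X P mu (l2fun f) (l2fun h).
Proof.
move=> fh; split; [exact: l2P|exact: l2P|].
have E t : (0 < t)%R ->
    normL2 mu (fun x => t^-1%:C%C * (semigroup X P t (l2fun f) x - l2fun f x) - l2fun h x)%R
    = (snorm dmu (t^-1 *: (Pt t f - f) - h)%R)%:E.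
  move=> t0; rewrite -normL2_snorm (semigroup_cond_exp markovX invmu) ?(ltW t0)//.
  by congr (normL2 _ _); apply/funext => x; rewrite scale_complexE.
apply/(cvg0_rightP E) => e e0; have [d d0 H] := fh e e0.
by exists d => // t /H; rewrite [in X in _ -> X]ger0_norm// snorm_ge0.
Qed.

Let gap_le (gamma : R) : gamma%:E <= gap X P mu K -> forall f h : l2 mu, KH f ->
  agen dmu I_ (@cond_exp _ _ _ _ _ P mu) f h -> (gamma * snorm dmu f <= snorm dmu h)%R.
Proof.
move=> gle f h Kf fh.
have [->|f0] := eqVneq (snorm dmu f) 0%R; first by rewrite mulr0 snorm_ge0.
have fp : (0 < snorm dmu f)%R by rewrite lt_def f0 snorm_ge0.
rewrite -ler_pdivlMr// -lee_fin; apply: (le_trans gle); apply: ereal_inf_lbound.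
exists (l2fun f), (l2fun h); split; first by split => //; exact: generator_agen.
  by rewrite normL2_snorm eqe.
by rewrite !normL2_snorm inver (negbTE f0) EFinM.
Qed.

Let K_closed (f : l2 mu) : (forall e : R, (0 < e)%R ->
  exists2 g, KH g & (snorm dmu (g - f) <= e)%R) -> KH f.
Proof.
move=> H; apply: (csub_closed subK (l2P f)) => e e0.
have [|g Kg gf] := H (e / 2)%R; first by rewrite divr_gt0.
exists (l2fun g) => //; rewrite -[normL2 _ _]/(normL2 mu (l2fun (g - f)%R)) normL2_snorm.
by rewrite lte_fin (le_lt_trans gf)// ltr_pdivrMr// ltr_pMr// ltr1n.
Qed.

Let variance_cauchy (gamma : R) (g : l2 mu) (s t : R) :
  (0 < gamma)%R -> gamma%:E <= gap X P mu K -> KH g -> (0 < s)%R -> (0 < t)%R ->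
  (`|snorm dP (Z 0%R t g) ^+ 2 / t - snorm dP (Z 0%R s g) ^+ 2 / s| <=
   4 / gamma ^+ 2 * snorm dmu g ^+ 2 * (t^-1 + s^-1))%R.
Proof.
move=> gamma0 gle; apply: (@second_moment_cauchy _ _ _ _ _ (@dot_semi_inner _ _ _ _)
  (@dot_semi_inner _ _ _ _) I_ (@cond_exp _ _ _ _ _ P mu) Z _ _ _ _ _ _ _ _ _ KH) => //.
- exact: at_timeD.
- exact: at_timeZ.
- by move=> r x y _; exact: dot_at_time.
- exact: dot_cond_exp.
- by move=> *; exact: chapman_kolmogorov.
- by move=> *; exact: dot_stationary.
- by move=> a b c x _; exact: path_integral_add.
- by move=> a b x M _; exact: path_integral_loc.
- exact: (csub_0 subK).
- by move=> x y; exact: (csub_add subK).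
- move=> a x /(csub_scale subK a%:C%C); rewrite /KH; congr K.
  by apply/funext => u; rewrite scale_complexE.
- by move=> r x r0 /(stableK r0); rewrite (semigroup_cond_exp markovX invmu).
- exact: gap_le.
Qed.

Let cint0 (g : l2 mu) : KH g -> cintegral mu setT (l2fun g) = 0%R.
Proof. by move=> /K0[]. Qed.

Let var_averageE (g : l2 mu) (t : R) : KH g -> (0 < t)%R ->
  var_average X P mu t (l2fun g) = (snorm dP (Z 0%R t g) ^+ 2 / t / t)%:E.
Proof.
move=> Kg t0; rewrite /var_average cint0// unlock.
have TA (w : Omega) : time_average X t (l2fun g) w = (t^-1%:C%C * l2fun (Z 0%R t g) w)%R.
  rewrite /time_average; congr (_ * _)%R; rewrite /= /cintegral; congr Complex.
    by apply: eq_Rintegral => s /set_mem/=; rewrite in_itv/= => /andP[s0 _]; rewrite stateE.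
  by apply: eq_Rintegral => s /set_mem/=; rewrite in_itv/= => /andP[s0 _]; rewrite stateE.
rewrite (eq_integral (fun w => (t^-1 ^+ 2)%:E * (rdot (l2fun (Z 0%R t g) w) (l2fun (Z 0%R t g) w))%:E)).
  have iZ := L2_integrable (l2P (Z 0%R t g)).
  rewrite integralZl//= (sqr_snorm (@dot_semi_inner _ _ _ _)).
  have := integrable_fin_num measurableT iZ => /fineK <-.
  by rewrite -EFinM; congr EFin; rewrite -[fine _]/(dP _ _); field; exact: lt0r_neq0.
move=> w _.
rewrite -[LHS]/((ComplexField.Normc.normc (time_average X t (l2fun g) w - 0) ^+ 2)%R%:E).
rewrite TA subr0 sqr_normc scale_complexE rdotZZ.
by rewrite EFinM.
Qed.

Hypothesis gap0 : 0 < gap X P mu K.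

(** An infinite gap gives the value 0, in accordance with [1 / +oo = 0], so that both
    cases share the bounds below. *)
Definition gap_const : R :=
  if gap X P mu K is gamma%:E then (4 / gamma ^+ 2)%R else 0%R.

Lemma gap_const_ge0 : (0 <= gap_const)%R.
Proof. by rewrite /gap_const; case: (gap X P mu K) => // r; rewrite divr_ge0 ?sqr_ge0. Qed.

Lemma gap_constE (t : R) : (0 < t)%R ->
  4%:E / (gap X P mu K ^+ 2 * t%:E ^+ 2) = (gap_const / t ^+ 2)%:E.
Proof.
move=> t0; have t20 : (0 < t ^+ 2)%R by rewrite exprn_gt0.
rewrite /gap_const; case: (gap X P mu K) gap0 => // [r|_].
  rewrite lte_fin => r0; rewrite -!EFin_expe -EFinM inver mulf_eq0 !expf_eq0/=.
  rewrite !gt_eqF//= -EFinM; congr EFin; field.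
  by rewrite !lt0r_neq0.
by rewrite expe2 mulyy -EFin_expe gt0_mulye ?lte_fin// invey mule0 mul0r.
Qed.

(** All quantities are finite on [K], so the variance bound becomes one between real
    numbers. *)
Lemma asymptotic_var_bound g : K g -> exists l n : R,
  [/\ asymptotic_var X P mu g = l%:E, normL2 mu g = n%:E &
  forall t, (0 < t)%R -> exists v : R, [/\ var_average X P mu t g = v%:E, (0 <= v)%R &
    (`|v - l / t| <= gap_const / t ^+ 2 * n ^+ 2)%R]].
Proof.
move=> Kg0; have Lg := csub_L2 subK Kg0.
pose g1 : l2 mu := MkL2 (mem_set Lg : (g : S -> Rcomplex R) \in L2pred mu).
have Kg : KH g1 by [].
pose v t := (snorm dP (Z 0%R t g1) ^+ 2 / t)%R.
set n := snorm dmu g1.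
have vc s t : (0 < s)%R -> (0 < t)%R ->
    (`|v t - v s| <= gap_const * n ^+ 2 * (t^-1 + s^-1))%R.
  move=> s0 t0; rewrite /gap_const; case E : (gap X P mu K) gap0 => [r| |] r0 //.
    by apply: variance_cauchy => //; rewrite E.
  (* An infinite gap is above [1 + q / e], for which the bound is at most [e]. *)
  rewrite mul0r mul0r; apply/ler_addgt0Pr => e e0; rewrite add0r.
  pose q := (4 * n ^+ 2 * (t^-1 + s^-1))%R.
  have q0 : (0 <= q)%R.
    apply: mulr_ge0; first by rewrite mulr_ge0 ?sqr_ge0.
    by apply: addr_ge0; rewrite invr_ge0 ltW.
  have := variance_cauchy (gamma := 1 + q / e) _ _ Kg s0 t0.
  have d0 : (0 <= q / e)%R by rewrite divr_ge0// ltW.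
  have d1 : (0 < 1 + q / e)%R by lra.
  rewrite E leey => /(_ d1 isT)/le_trans; apply.
  have -> : (4 / (1 + q / e) ^+ 2 * snorm dmu g1 ^+ 2 * (t^-1 + s^-1) =
      q / (1 + q / e) ^+ 2)%R by rewrite /q /n; move: (_ ^-1)%R => y; ring.
  rewrite ler_pdivrMr ?exprn_gt0//.
  apply: (@le_trans _ _ (e * (1 + q / e))%R).
    by rewrite mulrDr mulrCA divff ?lt0r_neq0// !mulr1 lerDr ltW.
  rewrite ler_pM2l// expr2 ler_pMr//; lra.
have [l vl H] := cvg_harmonic_osc vc.
exists l, n; split; last 2 first.
- exact: (normL2_snorm g1).
- move=> t t0; exists (v t / t)%R; split; first exact: (var_averageE Kg t0).
    exact: divr_ge0 (divr_ge0 (sqr_ge0 _) (ltW t0)) (ltW t0).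
  rewrite -mulrBl normrM [`|t^-1|%R]gtr0_norm ?invr_gt0// ler_pdivrMr//.
  apply: (le_trans (H t t0)).
  by rewrite le_eqVlt; apply/orP; left; apply/eqP; field; exact: lt0r_neq0.
rewrite /asymptotic_var; apply/cvg_lim => //.
have vE t : (0 < t)%R -> t%:E * var_average X P mu t g = (v t)%:E.
  move=> t0; rewrite (var_averageE Kg t0) -EFinM; congr EFin.
  by rewrite mulrC divfK// lt0r_neq0.
apply: cvg_EFin.
  by near=> t; rewrite vE.
apply: cvg_trans vl; apply: near_eq_cvg; near=> t.
by rewrite /= vE.
Unshelve. all: by end_near. Qed.

End Asymptotics.

Theorem theorem3 (R : realType)
    (dS : measure_display) (S : measurableType dS)
    (dO : measure_display) (Omega : measurableType dO)
    (X : R -> Omega -> S) (P : R.-pker S ~> Omega) (mu : probability S R)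
    (K : set (S -> R[i])) :
  markov_process X P ->
  invariant_law X P mu ->
  strongly_continuous X P mu ->
  closed_subspace mu K ->
  K `<=` L20 mu ->
  (forall (t : R) (g : S -> R[i]), (0 <= t)%R -> K g -> K (semigroup X P t g)) ->
  0 < gap X P mu K ->
  (forall (t : R) (g : S -> R[i]), (0 < t)%R -> K g ->
     `| var_average X P mu t g - asymptotic_var X P mu g / t%:E |
       <= 4%:E / (gap X P mu K ^+ 2 * t%:E ^+ 2) * normL2 mu g ^+ 2) /\
  (forall t : R, (0 < t)%R ->
     worst_asymptotic_var X P mu K / t%:E
         - 4%:E / (gap X P mu K ^+ 2 * t%:E ^+ 2)
       <= worst_deviation X P mu t K ^+ 2 /\
     worst_deviation X P mu t K ^+ 2
       <= worst_asymptotic_var X P mu K / t%:E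
         + 4%:E / (gap X P mu K ^+ 2 * t%:E ^+ 2)).
Proof.
move=> markovX invmu contP subK K0 stableK gap0.
have bound := asymptotic_var_bound markovX invmu contP subK K0 stableK gap0.
have divE (l t : R) : (0 < t)%R -> l%:E / t%:E = (l / t)%:E.
  by move=> t0; rewrite inver gt_eqF.
split=> [t g t0 Kg|t t0]; rewrite (gap_constE gap0 t0).
  have [l [n [-> -> /(_ t t0)[v [-> _ vl]]]]] := bound g Kg.
  by rewrite divE// -EFinB -EFin_expe -EFinM lee_fin.
set c := (gap_const X P mu K / t ^+ 2)%R.
have c0 : (0 <= c)%R by rewrite divr_ge0 ?gap_const_ge0 ?sqr_ge0.
rewrite /worst_asymptotic_var /worst_deviation /nnsup.
(* From here on only the bound on the unit sphere of [K] matters. *)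
set B := K `&` [set g | normL2 mu g = 1].
have unit_bound g : B g -> exists l v : R, [/\ asymptotic_var X P mu g = l%:E,
    var_average X P mu t g = v%:E, (0 <= v)%R & (`|v - l / t| <= c)%R].
  move=> [Kg g1]; have [l [n [-> gn /(_ t t0)[v [-> v0 vl]]]]] := bound g Kg.
  exists l, v; split => //; move: vl.
  have [->] : n%:E = 1%:E by rewrite -gn.
  by rewrite expr1n mulr1.
have [B0|/set0P[g0 Bg0]] := eqVneq B set0.
  rewrite B0 !image_set0 eqxx mul0e expe2 mule0 !add0e.
  by rewrite leeNl oppe0 lee_fin; split.
have img (F : (S -> R[i]) -> \bar R) : ([set F g | g in B] == set0) = false.
  by apply/negbTE/set0P; exists (F g0), g0.
rewrite !img.
set sigma := ereal_sup _; set delta := ereal_sup _.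
have delta0 : 0 <= delta.
  by apply: le_ereal_sup_tmp; exists (sqrte (var_average X P mu t g0)); [exists g0|exact: sqrte_ge0].
have varE g : B g -> var_average X P mu t g <= delta ^+ 2.
  move=> Bg; have [l [v [_ vE v0 _]]] := unit_bound g Bg.
  rewrite -(@sqr_sqrte _ (var_average X P mu t g)) ?vE ?lee_fin//.
  rewrite -vE !expe2; apply: lee_pmul; rewrite ?sqrte_ge0//.
    by apply: ereal_sup_ubound; exists g.
  by apply: ereal_sup_ubound; exists g.
split.
- rewrite leeBlDr//.
  have td : sigma <= t%:E * (delta ^+ 2 + c%:E).
    apply: ge_ereal_sup => _ [g Bg <-]; have [l [v [-> vE _ /ler_normlP[vl _]]]] := unit_bound g Bg.
    apply: (@le_trans _ _ (t%:E * (v + c)%:E)).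
      by rewrite -EFinM lee_fin mulrC -ler_pdivrMr//; lra.
    by rewrite lee_pmul2l// ?lte_fin// EFinD leeD2r// -vE varE.
  by rewrite inver gt_eqF// lee_pdivrMr// muleC.
- have sc : 0 <= sigma / t%:E + c%:E.
    have [l [v [lE vE v0 /ler_normlP[_ vl]]]] := unit_bound g0 Bg0.
    apply: (@le_trans _ _ ((l / t)%:E + c%:E)).
      by rewrite -EFinD lee_fin; lra.
    rewrite leeD2r// inver gt_eqF// EFinM lee_pmul2r ?lte_fin ?invr_gt0//.
    by apply: ereal_sup_ubound; exists g0.
  rewrite -[leRHS]sqr_sqrte// !expe2.
  have ds : delta <= sqrte (sigma / t%:E + c%:E).
    apply: ge_ereal_sup => _ [g Bg <-]; rewrite lee_sqrt//.
    have [l [v [lE vE v0 /ler_normlP[_ vl]]]] := unit_bound g Bg.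
    rewrite vE; apply: (@le_trans _ _ ((l / t)%:E + c%:E)).
      by rewrite -EFinD lee_fin; lra.
    rewrite leeD2r// inver gt_eqF// EFinM lee_pmul2r ?lte_fin ?invr_gt0//.
    by rewrite -lE; apply: ereal_sup_ubound; exists g.
  by apply: lee_pmul.
Qed.
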